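(* Let $R$ be an order in a finite product of number fields $K$ and $\mathfrak{l}$ a singular maximal ideal of $R$. Assume that $R$ has an $\mathfrak{l}$-multiplicator ladder, and let $\mathcal{O}_d\subsetneq\cdots\subsetneq\mathcal{O}_0$ be an $\mathfrak{l}$-multiplicator ladder in the set of overorders of $R$. (a) For $2\le i\le d$, $$\frac{\#\mathrm{Cl}(\mathcal{O}_i)}{\#\mathrm{Cl}(\mathcal{O}_{i-1})}=\frac{\#(R/\mathfrak{l})}{[\mathcal{O}_{i-1}^\times:\mathcal{O}_i^\times]}.$$ (b) If $R$ is Bass at $\mathfrak{l}$, then $$\frac{\#\mathrm{Cl}(\mathcal{O}_1)}{\#\mathrm{Cl}(\mathcal{O}_0)}=\frac{\#(R/\mathfrak{l})-\delta_\mathfrak{l}}{[\mathcal{O}_0^\times:\mathcal{O}_1^\times]},$$ where $\delta_\mathfrak{l}=-1,0,1$ if $\mathfrak{l}$ is inert, ramified, or split in $\mathcal{O}_0$, respectively.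
   Context: $(L:L')=\{x\in K:xL'\subseteq L\}$; conductor $\mathfrak{f}_S=(S:\mathcal{O}_K)$; a maximal ideal of $S$ is singular if it contains $\mathfrak{f}_S$. $\mathrm{Cl}(S)$ is the group of invertible fractional $S$-ideals modulo principal fractional ideals. An $\mathfrak{l}$-overorder of $R$ is an overorder $S$ with $(R:S)=R$ or $(R:S)$ $\mathfrak{l}$-primary. $S$ is Gorenstein at a maximal ideal $\mathfrak{m}$ if $\dim_{S/\mathfrak{m}}((S:\mathfrak{m})/S)=1$; $R$ is Bass at $\mathfrak{l}$ if every overorder of $R$ is Gorenstein at every one of its maximal ideals above $\mathfrak{l}$. A chain $R=R_d\subsetneq\cdots\subsetneq R_0$ is the $\mathfrak{l}$-multiplicator ladder of $R$ if $R_d,\ldots,R_0$ are all the $\mathfrak{l}$-overorders of $R$ and for $1\le i\le d$, $R_i$ has a unique maximal ideal $\mathfrak{L}_i$ above $\mathfrak{l}$, it is singular, and $R_{i-1}=(\mathfrak{L}_i:\mathfrak{L}_i)$ is the unique minimal $\mathfrak{l}$-overorder of $R_i$ (no order strictly in between). An $\mathfrak{l}$-multiplicator ladder in the set of overorders of $R$ is a chain $\mathcal{O}_d\subsetneq\cdots\subsetneq\mathcal{O}_0$ with $\mathcal{O}_d$ an overorder of $R$ satisfying $(\mathcal{O}_d)_\mathfrak{l}=R_\mathfrak{l}$ and forming the $\mathfrak{l}\mathcal{O}_d$-multiplicator ladder of $\mathcal{O}_d$. ''$\mathfrak{l}$ inert/ramified/split in $\mathcal{O}_0$'' means that $\mathfrak{l}\mathcal{O}_0$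 (which equals the unique maximal ideal of $\mathcal{O}_1$ above $\mathfrak{l}$) is, respectively, a maximal ideal of $\mathcal{O}_0$, the square of a maximal ideal of $\mathcal{O}_0$, or the product of two distinct maximal ideals of $\mathcal{O}_0$. *)

(* Defs.v *)
From HB Require Import structures.
From mathcomp Require Import all_boot all_order all_algebra all_field.
From mathcomp Require Import finmap all_classical.

Set Implicit Arguments.
Unset Strict Implicit.
Unset Printing Implicit Defensive.

Import GRing.Theory.
Local Open Scope classical_set_scope.
Local Open Scope ring_scope.

(* K is identified with the product of the F i by projections pr i with the
   universal property of a product. *)
Definition is_product_of_number_fields (K : comUnitRingType) : Prop :=
  exists (n : nat) (F : 'I_n -> fieldExtType rat)
         (pr : forall i, {rmorphism K -> F i}),
    forall y : (forall i, F i), exists! x : K, forall i, pr i x = y i.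

(* Meaningful only for finite X: it is 0 when X is infinite. *)
Definition ncard (T : choiceType) (X : set T) : nat := (#|` fset_set X |)%fset.

Definition cosets (T : Type) (op : T -> T -> T) (A B : set T) : set (set T) :=
  [set [set op a b | b in B] | a in A].

Section Orders.
Context {K : comUnitRingType}.
Implicit Types (R S T U L I J M P Q l : set K).

Definition is_submodule S I : Prop :=
  zmod_closed [in I] /\ forall a x, S a -> I x -> I (a * x).

Definition zspan (A : set K) : set K :=
  smallest (fun M => zmod_closed [in M]) A.

Definition is_lattice L : Prop :=
  (exists s : seq K, L = zspan [set` s]) /\
  forall x, exists2 m : nat, (0 < m)%N & L (x *+ m).

Definition is_order R : Prop := is_lattice R /\ subring_closed [in R].

Definition is_overorder R S : Prop := is_order S /\ R `<=` S.

Definition colon L L' : set K := [set x | forall y, L' y -> L (x * y)].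

Definition idmul I J : set K := zspan [set x * y | x in I & y in J].

Definition max_order : set K := [set x | integralOver (intr : int -> K) x].

Definition conductor S : set K := colon S max_order.

Definition is_ideal S I : Prop := is_submodule S I /\ I `<=` S.

Definition is_maximal_ideal S M : Prop :=
  [/\ is_ideal S M, M <> S &
      forall J, is_ideal S J -> M `<=` J -> J = M \/ J = S].

Definition is_singular S M : Prop :=
  is_maximal_ideal S M /\ conductor S `<=` M.

(* M is a maximal ideal of the overorder S of R lying above the ideal l of R. *)
Definition is_maximal_above R l S M : Prop :=
  is_maximal_ideal S M /\ M `&` R = l.

Definition is_primary_for R l Q : Prop :=
  [/\ is_ideal R Q, Q <> R,
      forall x y, R x -> R y -> Q (x * y) -> Q x \/ exists n, Q (y ^+ n) &
      [set x | R x /\ exists n, Q (x ^+ n)] = l].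

Definition is_loverorder R l S : Prop :=
  is_overorder R S /\ (colon R S = R \/ is_primary_for R l (colon R S)).

Definition is_minimal_loverorder R l S T : Prop :=
  [/\ is_loverorder R l T, S `<` T &
      forall U, is_order U -> ~ (S `<` U /\ U `<` T)].

(* Only the values O_ i with i <= d matter. *)
Definition is_multiplicator_ladder R l (d : nat) (O_ : nat -> set K) : Prop :=
  [/\ O_ d = R,
      forall i, (1 <= i <= d)%N -> O_ i `<` O_ i.-1,
      [set S | is_loverorder R l S] = [set O_ i | i in [set i | (i <= d)%N]] &
      forall i, (1 <= i <= d)%N ->
        exists L, [/\ [set M | is_maximal_above R l (O_ i) M] = [set L],
                      is_singular (O_ i) L,
                      O_ i.-1 = colon L L &
                      [set T | is_minimal_loverorder R l (O_ i) T]
                        = [set O_ i.-1]]].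

(* The fraction x / s of the localization K_l = (R \ l)^-1 K, as the class of
   the pair (x, s).  R \ l may contain zero divisors, so K_l need not contain
   R and cannot be replaced by K itself. *)
Definition locfrac R l (x s : K) : set (K * K) :=
  [set p | (R `\` l) p.2 /\
           exists2 u, (R `\` l) u & u * (p.2 * x - s * p.1) = 0].

(* S_l, as a subset of K_l *)
Definition localization R l S : set (set (K * K)) :=
  [set locfrac R l x s | x in S & s in R `\` l].

Definition is_ladder_in_overorders R l (d : nat) (O_ : nat -> set K) : Prop :=
  [/\ is_overorder R (O_ d),
      localization R l (O_ d) = localization R l R &
      is_multiplicator_ladder (O_ d) (idmul l (O_ d)) d O_].

(* The S/M-vector space V/W, with W `<=` V two S-modules such that M V is
   contained in W, has a basis of n elements. *)
Definition has_quotient_dim S M (V W : set K) (n : nat) : Prop :=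
  exists v : 'I_n -> K,
    [/\ forall i, V (v i),
        forall x, V x -> exists2 a : 'I_n -> K,
          forall i, S (a i) & W (x - \sum_i a i * v i) &
        forall a : 'I_n -> K, (forall i, S (a i)) ->
          W (\sum_i a i * v i) -> forall i, M (a i)].

Definition is_gorenstein_at S M : Prop := has_quotient_dim S M (colon S M) S 1%N.

Definition is_bass_at R l : Prop :=
  forall S M, is_overorder R S -> is_maximal_above R l S M ->
    is_gorenstein_at S M.

Definition is_fractional_ideal S I : Prop := is_lattice I /\ is_submodule S I.

Definition invertible_ideals S : set (set K) :=
  [set I | is_fractional_ideal S I /\
           exists2 J, is_fractional_ideal S J & idmul I J = S].

Definition principal_ideals S : set (set K) :=
  [set [set x * y | y in S] | x in [set x | x \is a GRing.unit]].

(* The class of I is its coset modulo the principal fractional ideals. *)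
Definition Cl S : set (set (set K)) :=
  cosets idmul (invertible_ideals S) (principal_ideals S).

Definition units S : set K := [set x | S x /\ exists2 y, S y & x * y = 1].

Definition unit_cosets S T : set (set K) := cosets *%R (units S) (units T).

Definition residue_ring R l : set (set K) := cosets +%R R l.

Definition is_inert l T : Prop := is_maximal_ideal T (idmul l T).

Definition is_ramified l T : Prop :=
  exists2 P, is_maximal_ideal T P & idmul l T = idmul P P.

Definition is_split l T : Prop :=
  exists P Q, [/\ is_maximal_ideal T P, is_maximal_ideal T Q, P <> Q &
                  idmul l T = idmul P Q].

Definition is_delta l T (delta : int) : Prop :=
  [\/ is_inert l T /\ delta = -1, is_ramified l T /\ delta = 0 |
      is_split l T /\ delta = 1].

End Orders.

(* Main.v *)
Require Import Defs.
From HB Require Import structures.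
From mathcomp Require Import all_boot all_order all_algebra all_field.
From mathcomp Require Import finmap all_classical.
From mathcomp Require Import ring.

Set Implicit Arguments.
Unset Strict Implicit.
Unset Printing Implicit Defensive.

Import Order.TTheory GRing.Theory Num.Theory.
Local Open Scope classical_set_scope.
Local Open Scope ring_scope.

(* Part (a) and part (b) both count the fibres of Cl(S) -> Cl(T), where S = O_i,
   T = O_(i-1) = (L : L) and L is the maximal ideal of S above l, which is an ideal of
   T as well.  An invertible S-ideal I with I T = T contains L, and is of the form
   u S + L with u a unit of T modulo L; sending z in T^x to z S, such ideals are
   permuted freely by T^x / S^x, so that
     #Cl(S) [T^x : S^x] = #Cl(T) #{u S + L}.
   In all cases T = S + S theta + L.  The lines u S + L are S itself and the
   (a + theta) S + L with a in S/L such that a + theta is a unit modulo L; a residue a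
   for which it is not one gives the maximal ideal (a + theta) S + L of T.  There are
   0, 1 or 2 such residues, according as T/L is a field, k[e] or k x k.

   In (a), T/L is local, and theta is any element killed by its maximal ideal: then
   S + S theta + L is a ring, which is T because T is minimal over S.  In (b), theta
   comes from the Gorenstein property of S at L, and the Gorenstein property of T at P,
   together with the maximality of T among the l-overorders, gives P ^ 2 = L in the
   ramified case.

   Finiteness of the class groups is the Jordan-Zassenhaus argument: in each component
   of K, a lattice has an element of minimal norm, and Dirichlet approximation makes the
   lattice a multiple of this element up to a bounded denominator.  The same argument
   shows that an order has finitely many overorders, so that conductors have finite
   index; this is what makes d positive when l is singular. *)

(** * Counting and additive subgroups *)

(** No group structure is put on the class sets: the exact sequence relating units, residues and
    class groups is replaced by counting one set of ideals in two ways. What comes out speaks of O_i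
    / L_i and of L_1, whereas the statement speaks of R / l and of l O_0. Both gaps are closed by
    descending the ladder from O_d: O_(i-1) = O_i + L_(i-1) keeps the residue field equal to R / l,
    and L_i O_(i-2) = L_(i-1) leads to l O_0 = L_1. The descent starts from equality of
    localizations, in the form of an element t of R outside l with t O_d contained in R. What
    separates (a) from (b) is whether the ladder goes on above T. For i >= 2 the ring (L_(i-1) :
    L_(i-1)) = O_(i-2) is larger than O_(i-1), so L_(i-1) differs from L_i and T/L is not a field.
    For i = 1 there is no further step, and all three types of T/L can occur. As K may have zero
    divisors, elements chosen in the separate components have to be glued by integral multiples of
    idempotents, and the fractions of the localization keep an extra factor. *)

Lemma ncard_image (T U : choiceType) (f : T -> U) (A : set T) :
  finite_set A -> {in A &, injective f} -> ncard (f @` A) = ncard A.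
Proof.
move=> fA finj; apply/fcard_eq => //; first exact: finite_image.
exact: inj_card_eq.
Qed.

Lemma ncardD1 (T : choiceType) (A : set T) (x : T) :
  finite_set A -> A x -> ncard A = (ncard (A `\ x)).+1.
Proof.
move=> fA Ax; rewrite /ncard (cardfsD1 x) fset_setD1 // in_fset_set //.
by rewrite mem_set.
Qed.

Lemma ncard0 (T : choiceType) : ncard (set0 : set T) = 0%N.
Proof. by rewrite /ncard fset_set0 cardfs0. Qed.

(** Finiteness of [A] is a conclusion: the set of ideals counted later is seen to be finite through
    its fibres. *)
Lemma ncard_fibers (T U V : choiceType) (f : T -> U) (A : set T) (C : set V) :
  finite_set (f @` A) -> finite_set C ->
  (forall b, (f @` A) b -> exists2 g : V -> T, {in C &, injective g} &
     g @` C = A `&` f @^-1` [set b]) ->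
  finite_set A /\ ncard A = (ncard C * ncard (f @` A))%N.
Proof.
move=> fB fC fib.
have fibf b : (f @` A) b -> finite_set (A `&` f @^-1` [set b]).
  by move=> /fib [g _ <-]; exact: finite_image.
have fA : finite_set A.
  have -> : A = \bigcup_(b in f @` A) (A `&` f @^-1` [set b]).
    apply/seteqP; split=> [a Aa|a [b _ [Aa _]]] //.
    by exists (f a); [exists a | split].
  exact: bigcup_finite.
split=> //; rewrite /ncard.
rewrite card_fset_sum1 (partition_big_imfset _ f) -fset_set_image //.
rewrite mulnC [in RHS]card_fset_sum1 big_distrl /= big_seq [RHS]big_seq.
apply: eq_bigr => b; rewrite in_fset_set; last exact: finite_image.
move=> /set_mem fb; have [g ginj gC] := fib b fb.
rewrite mul1n -[RHS](ncard_image fC ginj) gC /ncard card_fset_sum1.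
rewrite big_fset_condE; apply: eq_fbigl => a.
rewrite !inE /= [in RHS]in_fset_set; last exact: fibf.
have -> : (a \in [eta mem_seq (fset_set A)]) = (a \in A) by rewrite -in_fset_set.
apply/andP/idP => [[/set_mem Aa /eqP fa]|/set_mem [Aa <-]]; last by rewrite mem_set.
exact: mem_set.
Qed.

Lemma finite_subsets (T : choiceType) (I : finType) (h : {set I} -> T)
  (A : set T) : (forall a, A a -> exists F, a = h F) -> finite_set A.
Proof.
move=> hA; apply: (@sub_finite_set _ _ [set h F | F in setT]).
  by move=> a /hA [F ->]; exists F.
exact/finite_image/finite_finset.
Qed.

Section AdditiveSubgroups.
Context {K : comUnitRingType}.
Implicit Types (A B I J L M S T : set K) (x y z : K).

Lemma zmodP M :
  zmod_closed [in M] <-> M 0 /\ forall x y, M x -> M y -> M (x - y).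
Proof.
split=> [[M0 MB]|[M0 MB]]; split.
- exact: set_mem.
- by move=> x y Mx My; apply/set_mem/MB; apply/mem_set.
- exact: mem_set.
- by move=> x y /set_mem Mx /set_mem My; apply/mem_set/MB.
Qed.

Lemma zmod0 M : zmod_closed [in M] -> M 0. Proof. by case/zmodP. Qed.

Lemma zmodB M x y : zmod_closed [in M] -> M x -> M y -> M (x - y).
Proof. by case/zmodP=> _; apply. Qed.

Lemma zmodN M x : zmod_closed [in M] -> M x -> M (- x).
Proof. by move=> zM Mx; rewrite -sub0r; apply: zmodB => //; exact: zmod0. Qed.

Lemma zmodD M x y : zmod_closed [in M] -> M x -> M y -> M (x + y).
Proof.
by move=> zM Mx My; rewrite -(opprK y); apply: zmodB => //; exact: zmodN.
Qed.

Lemma zmod_sum M (I : Type) (r : seq I) (P : pred I) (F : I -> K) :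
  zmod_closed [in M] -> (forall i, P i -> M (F i)) -> M (\sum_(i <- r | P i) F i).
Proof.
move=> zM FM; apply: big_ind => //; first exact: zmod0.
by move=> x y; exact: zmodD.
Qed.

Lemma zmodMn M x n : zmod_closed [in M] -> M x -> M (x *+ n).
Proof.
move=> zM Mx; elim: n => [|n IH]; first by rewrite mulr0n; exact: zmod0.
by rewrite mulrS; exact: zmodD.
Qed.

Lemma zmodMz M x (n : int) : zmod_closed [in M] -> M x -> M (x *~ n).
Proof.
move=> zM Mx; case: n => n; first by rewrite -pmulrn; exact: zmodMn.
by rewrite NegzE mulrNz; apply: zmodN => //; rewrite -pmulrn; exact: zmodMn.
Qed.

Lemma zspan_zmod A : zmod_closed [in zspan A].
Proof.
apply/zmodP; split=> [M [zM _]|x y Ax Ay M HM]; first exact: zmod0.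
by apply: zmodB (Ax M HM) (Ay M HM); case: HM.
Qed.

Lemma sub_zspan A : A `<=` zspan A.
Proof. by move=> x Ax M [_]; apply. Qed.

Lemma zspan_sub A M : zmod_closed [in M] -> A `<=` M -> zspan A `<=` M.
Proof. by move=> zM AM x; apply. Qed.

Lemma zspan_seq (s : seq K) x : zspan [set` s] x ->
  exists z : 'I_(size s) -> int, x = \sum_(i < size s) s`_i *~ z i.
Proof.
apply: (@zspan_sub _
  [set x | exists z : 'I_(size s) -> int, x = \sum_(i < size s) s`_i *~ z i]).
  apply/zmodP; split; first by exists (fun=> 0); rewrite big1.
  move=> _ _ [z ->] [t ->]; exists (fun i => z i - t i).
  by rewrite -sumrB; apply: eq_bigr => i _; rewrite mulrzBr.
move=> y /= ys; have ilt : (index y s < size s)%N by rewrite index_mem.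
exists (fun j => (j == Ordinal ilt)%:Z).
rewrite (bigD1 (Ordinal ilt)) //= big1 => [|j /negPf -> //].
by rewrite eqxx addr0 nth_index.
Qed.

Lemma idmul_zmod I J : zmod_closed [in idmul I J].
Proof. exact: zspan_zmod. Qed.

Lemma mem_idmul I J x y : I x -> J y -> idmul I J (x * y).
Proof. by move=> Ix Jy; apply: sub_zspan; exists x => //; exists y. Qed.

Lemma idmul_sub I J M : zmod_closed [in M] ->
  (forall x y, I x -> J y -> M (x * y)) -> idmul I J `<=` M.
Proof.
by move=> zM IJM; apply: zspan_sub => // _ [x Ix] [y Jy] <-; exact: IJM.
Qed.

Lemma idmulC I J : idmul I J = idmul J I.
Proof.
have C A B : idmul A B `<=` idmul B A.
  apply: idmul_sub; first exact: idmul_zmod.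
  by move=> x y Ax By; rewrite mulrC; exact: mem_idmul.
by apply/seteqP; split; exact: C.
Qed.

Lemma zmod_preimage M z : zmod_closed [in M] ->
  zmod_closed [in [set x | M (z * x)]].
Proof.
move=> zM; apply/zmodP; split=> [|x y Mx My] /=.
  by rewrite mulr0; exact: zmod0.
by rewrite mulrBr; exact: zmodB.
Qed.

Lemma zmod_setI M N : zmod_closed [in M] -> zmod_closed [in N] ->
  zmod_closed [in M `&` N].
Proof.
move=> zM zN; apply/zmodP; split; first by split; exact: zmod0.
by move=> x y [Mx Nx] [My Ny]; split; exact: zmodB.
Qed.

Lemma idmulA I J L : idmul I (idmul J L) = idmul (idmul I J) L.
Proof.
have half A B C : idmul A (idmul B C) `<=` idmul (idmul A B) C.
  apply: idmul_sub => [|x y Ax]; first exact: idmul_zmod.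
  move: y; apply: idmul_sub.
    by apply: zmod_preimage; exact: idmul_zmod.
  move=> y z By Cz /=; rewrite mulrA.
  by apply: mem_idmul => //; apply: mem_idmul.
apply/seteqP; split; first exact: half.
have := half L J I.
by rewrite (idmulC J I) (idmulC L (idmul I J)) (idmulC L J) (idmulC (idmul J L)).
Qed.

Lemma idmulS I J I' J' : I `<=` I' -> J `<=` J' -> idmul I J `<=` idmul I' J'.
Proof.
move=> sI sJ; apply: idmul_sub => [|x y Ix Jy]; first exact: idmul_zmod.
by apply: mem_idmul; [exact: sI | exact: sJ].
Qed.

Lemma submodM S I x y : is_submodule S I -> S x -> I y -> I (x * y).
Proof. by case=> _; apply. Qed.

Lemma submod_zmod S I : is_submodule S I -> zmod_closed [in I].
Proof. by case. Qed.

Lemma idmul_submod S I J : is_submodule S I -> is_submodule S (idmul I J).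
Proof.
move=> mI; split=> [|a x Sa]; first exact: idmul_zmod.
move: x; apply: idmul_sub; first by apply: zmod_preimage; exact: idmul_zmod.
by move=> x y Ix Jy /=; rewrite mulrA; apply: mem_idmul => //; exact: (submodM mI).
Qed.

Lemma idmul1 S I : S 1 -> is_submodule S I -> idmul S I = I.
Proof.
move=> S1 mI; apply/seteqP; split=> [|x Ix].
  by apply: idmul_sub; [exact: submod_zmod mI | move=> x y; exact: submodM].
by rewrite -[x]mul1r; exact: mem_idmul.
Qed.

Definition scale x I : set K := [set x * y | y in I].

Lemma scale1 I : scale 1 I = I.
Proof.
apply/seteqP; split=> [_ [y Iy <-]|y Iy]; first by rewrite mul1r.
by exists y; rewrite ?mul1r.
Qed.

Lemma scaleM x y I : scale x (scale y I) = scale (x * y) I.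
Proof.
apply/seteqP; split=> [_ [_ [z Iz <-] <-]|_ [z Iz <-]].
  by exists z; rewrite ?mulrA.
by exists (y * z); rewrite ?mulrA //; exists z.
Qed.

Lemma scale_zmod x I : zmod_closed [in I] -> zmod_closed [in scale x I].
Proof.
move=> zI; apply/zmodP; split; first by exists 0; rewrite ?mulr0 //; exact: zmod0.
move=> _ _ [y Iy <-] [z Iz <-]; exists (y - z); first exact: zmodB.
by rewrite mulrBr.
Qed.

Lemma scale_submod S x I : is_submodule S I -> is_submodule S (scale x I).
Proof.
move=> mI; split; first by apply: scale_zmod; exact: submod_zmod mI.
by move=> a _ Sa [y Iy <-]; exists (a * y); [exact: (submodM mI) | ring].
Qed.

Lemma mem_scale x I y : x \is a GRing.unit -> scale x I y <-> I (x^-1 * y).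
Proof.
move=> ux; split=> [[z Iz <-]|Iy]; first by rewrite mulKr.
by exists (x^-1 * y) => //; rewrite mulVKr.
Qed.

Lemma scaleK x I : x \is a GRing.unit -> scale x^-1 (scale x I) = I.
Proof. by move=> ux; rewrite scaleM mulVr // scale1. Qed.

Lemma scaleVK x I : x \is a GRing.unit -> scale x (scale x^-1 I) = I.
Proof. by move=> ux; rewrite scaleM mulrV // scale1. Qed.

Lemma idmul_scale x I J : idmul (scale x I) J = scale x (idmul I J).
Proof.
apply/seteqP; split.
  apply: idmul_sub; first by apply: scale_zmod; exact: idmul_zmod.
  move=> _ z [y Iy <-] Jz; exists (y * z); first exact: mem_idmul.
  by rewrite mulrA.
move=> _ [y Hy <-]; move: y Hy; apply: idmul_sub.
  by apply: zmod_preimage; exact: idmul_zmod.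
by move=> y z Iy Jz /=; rewrite mulrA; apply: mem_idmul => //; exists y.
Qed.

Lemma idmul_principal S x I : S 1 -> is_submodule S I ->
  idmul I (scale x S) = scale x I.
Proof. by move=> S1 mI; rewrite idmulC idmul_scale idmul1. Qed.

Lemma order_lattice S : is_order S -> is_lattice S. Proof. by case. Qed.

Lemma order_zmod S : is_order S -> zmod_closed [in S].
Proof.
move=> [_ /[dup] Sr [S1 SB _]]; apply/zmodP; split=> [|x y Sx Sy].
  by rewrite -(subrr 1); apply/set_mem/SB.
by apply/set_mem/SB; apply/mem_set.
Qed.

Lemma order1 S : is_order S -> S 1. Proof. by case=> _ [/set_mem]. Qed.

Lemma orderM S x y : is_order S -> S x -> S y -> S (x * y).
Proof. by move=> [_ [_ _ SM]] Sx Sy; apply/set_mem/SM; apply/mem_set. Qed.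

Lemma orderX S x n : is_order S -> S x -> S (x ^+ n).
Proof.
move=> oS Sx; elim: n => [|n IH]; first by rewrite expr0; exact: order1.
by rewrite exprS; exact: orderM.
Qed.

Lemma orderP S : is_lattice S -> zmod_closed [in S] -> S 1 ->
  (forall x y, S x -> S y -> S (x * y)) -> is_order S.
Proof.
move=> lS zS S1 SM; split=> //; split; first exact: mem_set.
  by move=> x y /set_mem Sx /set_mem Sy; apply: mem_set; exact: zmodB.
by move=> x y /set_mem Sx /set_mem Sy; apply: mem_set; exact: SM.
Qed.

Lemma order_submod S T : is_order T -> S `<=` T -> is_submodule S T.
Proof.
move=> oT ST; split; first exact: order_zmod.
by move=> a x /ST; exact: orderM.
Qed.

Lemma submod_sub S T I : S `<=` T -> is_submodule T I -> is_submodule S I.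
Proof. by move=> ST [zI mI]; split=> // a x /ST; exact: mI. Qed.

Lemma idmul_order S : is_order S -> idmul S S = S.
Proof. by move=> oS; apply: idmul1; [exact: order1|exact: order_submod]. Qed.

Lemma colon_zmod I J : zmod_closed [in I] -> zmod_closed [in colon I J].
Proof.
move=> zI; apply/zmodP; split=> [y _|x y Hx Hy z Jz].
  by rewrite mul0r; exact: zmod0.
by rewrite mulrBl; apply: zmodB => //; [exact: Hx | exact: Hy].
Qed.

Lemma colon_submod S I J : is_submodule S I -> is_submodule S (colon I J).
Proof.
move=> mI; split; first by apply: colon_zmod; exact: submod_zmod mI.
by move=> a x Sa Hx y Jy; rewrite -mulrA; apply: submodM mI Sa _; exact: Hx.
Qed.

Lemma colon_self_mul I x y : colon I I x -> colon I I y -> colon I I (x * y).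
Proof. by move=> Hx Hy z Iz; rewrite -mulrA; apply/Hx/Hy. Qed.

Lemma colon_self1 I : colon I I 1.
Proof. by move=> y Iy; rewrite mul1r. Qed.

Lemma colon_self_submod I : zmod_closed [in I] -> is_submodule (colon I I) I.
Proof. by move=> zI; split=> // a x; apply. Qed.

End AdditiveSubgroups.

(** * Lattices *)

Section Lattices.
Context {K : comUnitRingType}.
Implicit Types (A B I J L M S T : set K) (x y z : K).

(** This lets a lattice be divided by an integer inside [K], as colon lattices require. *)
Definition natunits (F : comUnitRingType) : Prop :=
  forall m, (0 < m)%N -> (m%:R : F) \is a GRing.unit.

Lemma lattice_zmod L : is_lattice L -> zmod_closed [in L].
Proof. by move=> [[s ->] _]; exact: zspan_zmod. Qed.

Lemma lattice_full L x : is_lattice L -> exists2 m : nat, (0 < m)%N & L (x *+ m).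
Proof. by case=> _; apply. Qed.

Lemma lattice_absorb B M : is_lattice B -> zmod_closed [in M] ->
  (forall x, exists2 m : nat, (0 < m)%N & M (x *+ m)) ->
  exists2 m : nat, (0 < m)%N & forall x, B x -> M (x *+ m).
Proof.
move=> [[s ->] _] zM fM.
have [m m0 Hm] : exists2 m : nat, (0 < m)%N & forall x, x \in s -> M (x *+ m).
  elim: s => [|a s [m m0 Hm]]; first by exists 1%N.
  have [k k0 Hk] := fM a; exists (k * m)%N; first by rewrite muln_gt0 k0.
  move=> x; rewrite inE => /orP [/eqP ->|xs].
    by rewrite mulrnA; exact: zmodMn.
  by rewrite mulnC mulrnA; apply: zmodMn => //; exact: Hm.
exists m => // x sx; move: x sx; apply: (@zspan_sub _ _ [set x | M (x *+ m)]) => //.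
apply/zmodP; split=> [|x y Mx My] /=; first by rewrite mul0rn; exact: zmod0.
by rewrite mulrnBl; exact: zmodB.
Qed.

(* Division with remainder of the coordinates by m: the classes of B modulo mB
   are represented by the combinations of generators with coefficients < m. *)
Lemma lattice_residues B M : is_lattice B -> zmod_closed [in M] ->
  (forall x, exists2 m : nat, (0 < m)%N & M (x *+ m)) ->
  exists (I : finType) (h : I -> K), forall x, B x ->
    exists i, M (x - h i) /\ forall L, zmod_closed [in L] -> B `<=` L -> L (h i).
Proof.
move=> lB zM fM; have [[s Bs] _] := lB.
have [m m0 Hm] := lattice_absorb lB zM fM.
exists {ffun 'I_(size s) -> 'I_m}, (fun f : {ffun 'I_(size s) -> 'I_m} => \sum_(i < size s) s`_i *+ f i).
have sB i : (i < size s)%N -> B s`_i.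
  by move=> ilt; rewrite Bs; apply: sub_zspan; rewrite /= mem_nth.
have lt (z : int) : (`|(z %% m)%Z|%N < m)%N.
  have mn0 : (m%:Z != 0) by rewrite -lt0n.
  by rewrite -ltz_nat gez0_abs ?modz_ge0 // ltz_pmod.
move=> x; rewrite {1}Bs => /zspan_seq [z ->].
exists [ffun i => Ordinal (lt (z i))]; split; last first.
  move=> L zL BL; apply: zmod_sum => // i _; apply: zmodMn => //.
  exact/BL/sB.
rewrite -sumrB; apply: zmod_sum => // i _; rewrite ffunE /=.
have mn0 : (m%:Z != 0) by rewrite -lt0n.
have -> : s`_i *~ z i - s`_i *+ `|(z i %% m)%Z|%N = (s`_i *+ m) *~ (z i %/ m)%Z.
  rewrite pmulrn gez0_abs ?modz_ge0 // -mulrzBr pmulrn -mulrzA.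
  congr (_ *~ _); rewrite {1}(divz_eq (z i) m) addrK; exact: mulrC.
by apply: zmodMz => //; apply/Hm/sB.
Qed.

(** Finite generation by hand: [M] contains some [m B], hence is generated by [m B] and those of the
    finitely many representatives of [B] modulo [m B] that lie in [M]. *)
Lemma sub_lattice B M : is_lattice B -> zmod_closed [in M] -> M `<=` B ->
  (forall x, exists2 m : nat, (0 < m)%N & M (x *+ m)) -> is_lattice M.
Proof.
move=> lB zM MB fM; split=> //.
have [m m0 Hm] := lattice_absorb lB zM fM.
pose mB : set K := [set x *+ m | x in B].
have zmB : zmod_closed [in mB].
  apply/zmodP; split.
    by exists 0; rewrite ?mul0rn //; apply: zmod0; exact: lattice_zmod.
  move=> _ _ [x Bx <-] [y By <-]; exists (x - y); last by rewrite mulrnBl.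
  by apply: zmodB => //; exact: lattice_zmod.
have fmB x : exists2 k : nat, (0 < k)%N & mB (x *+ k).
  have [k k0 Bk] := lattice_full x lB; exists (k * m)%N; first by rewrite muln_gt0 k0.
  by exists (x *+ k) => //; rewrite mulrnA.
have [[s Bs] _] := lB; have [I [h Hh]] := lattice_residues lB zmB fmB.
exists ([seq x *+ m | x <- s] ++ [seq h i | i <- enum I & `[< M (h i) >]]).
apply/seteqP; split; last first.
  apply: zspan_sub => // x /=; rewrite mem_cat => /orP [/mapP [y ys ->]|].
    by apply: Hm; rewrite Bs; exact: sub_zspan.
  by move=> /mapP [i]; rewrite mem_filter => /andP [/asboolP Mh _] ->.
set G := zspan _; have zG : zmod_closed [in G] by exact: zspan_zmod.
move=> x Mx; have [i [[y By yE] _]] := Hh x (MB _ Mx).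
have Gy : G (y *+ m).
  move: {yE} y By; rewrite Bs.
  apply: (@zspan_sub _ _ [set y | G (y *+ m)]).
    apply/zmodP; split=> [|a b Ga Gb] /=; first by rewrite mul0rn; exact: (zmod0 zG).
    by rewrite mulrnBl; exact: (zmodB zG).
  move=> y ys /=; apply: sub_zspan => /=; rewrite mem_cat; apply/orP; left.
  exact: map_f.
have hE : h i = x - y *+ m by rewrite yE; ring.
have -> : x = y *+ m + h i by rewrite hE; ring.
apply: (zmodD zG) => //; apply: sub_zspan => /=; rewrite mem_cat; apply/orP; right.
apply: map_f; rewrite mem_filter mem_enum andbT; apply/asboolP.
by rewrite hE; apply: zmodB => //; exact: Hm.
Qed.

(** [M] is a union of cosets of [A], so it is recovered from the representatives of [B] modulo [A]
    that it contains. *)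
Lemma finite_between A B : is_lattice A -> is_lattice B ->
  finite_set [set M : set K | [/\ zmod_closed [in M], A `<=` M & M `<=` B]].
Proof.
move=> lA lB.
have [I [h Hh]] := lattice_residues lB (lattice_zmod lA) (fun x => lattice_full x lA).
apply: (@finite_subsets _ I (fun F : {set I} => [set x | exists2 i, i \in F & A (x - h i)])).
move=> M [zM AM MB]; exists [set i | `[< M (h i) >]]%SET.
apply/seteqP; split=> [x Mx|x [i]].
  have [i [Axi _]] := Hh x (MB _ Mx); exists i => //; rewrite inE.
  by apply/asboolP; rewrite -[h i](subKr x); apply: zmodB => //; exact: AM.
rewrite inE => /asboolP Mi /AM Axi; rewrite -(subrK (h i) x).
exact: zmodD.
Qed.

Lemma mem_coset A x y : zmod_closed [in A] ->
  ([set x + b | b in A] = [set y + b | b in A]) <-> A (x - y).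
Proof.
move=> zA; split=> [E|Axy].
  have : [set x + b | b in A] x by exists 0; rewrite ?addr0 //; exact: zmod0.
  by rewrite E => -[b Ab <-]; rewrite addrAC subrr add0r.
apply/seteqP; split=> [_ [b Ab <-]|_ [b Ab <-]].
  by exists ((x - y) + b); [exact: zmodD | ring].
by exists (b - (x - y)); [exact: zmodB | ring].
Qed.

Lemma finite_cosets A B : is_lattice A -> is_lattice B ->
  finite_set (cosets +%R B A).
Proof.
move=> lA lB; have zA := lattice_zmod lA.
have [I [h Hh]] := lattice_residues lB zA (fun x => lattice_full x lA).
apply: (@sub_finite_set _ _ [set [set h i + b | b in A] | i in [set: I]]).
  move=> _ [x Bx <-]; have [i [Axi _]] := Hh x Bx; exists i => //.
  by apply/mem_coset => //; rewrite -opprB; exact: zmodN.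
exact/finite_image/finite_finset.
Qed.

Lemma scale_lattice x L : x \is a GRing.unit -> is_lattice L -> is_lattice (scale x L).
Proof.
move=> ux lL; split; last first.
  move=> y; have [m m0 Lm] := lattice_full (x^-1 * y) lL; exists m => //.
  by apply/mem_scale; rewrite ?mulrnAr.
have [[s Ls] _] := lL; exists [seq x * y | y <- s]; apply/seteqP; split.
  move=> _ [y Ly <-]; move: y Ly; rewrite Ls; apply: zspan_sub.
    by apply: zmod_preimage; exact: zspan_zmod.
  by move=> y ys /=; apply: sub_zspan => /=; exact: map_f.
apply: zspan_sub; first by apply: scale_zmod; exact: lattice_zmod.
move=> _ /= /mapP [y ys ->]; exists y => //; rewrite Ls; exact: sub_zspan.
Qed.

Lemma idmul_lattice I J : is_lattice I -> is_lattice J -> is_lattice (idmul I J).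
Proof.
move=> lI lJ; split; last first.
  move=> x; have [m m0 Im] := lattice_full 1 lI.
  have [k k0 Jk] := lattice_full x lJ; exists (m * k)%N; first by rewrite muln_gt0 m0.
  have -> : x *+ (m * k) = 1 *+ m * (x *+ k).
    by rewrite mulrnAl mul1r -mulrnA mulnC.
  exact: mem_idmul.
have [[s Is] _] := lI; have [[t Jt] _] := lJ.
exists [seq x * y | x <- s, y <- t]; apply/seteqP; split.
  apply: idmul_sub; first exact: zspan_zmod.
  move=> x y Ix; move: y; rewrite Jt; apply: zspan_sub.
    by apply: zmod_preimage; exact: zspan_zmod.
  move=> y yt /=; rewrite mulrC; move: x Ix; rewrite Is; apply: zspan_sub.
    by apply: zmod_preimage; exact: zspan_zmod.
  move=> x xs /=; rewrite mulrC; apply: sub_zspan => /=.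
  by apply/allpairsP; exists (x, y).
apply: zspan_sub; first exact: idmul_zmod.
move=> _ /= /allpairsP [[x y] /= [xs yt ->]]; apply: mem_idmul.
  by rewrite Is; exact: sub_zspan.
by rewrite Jt; exact: sub_zspan.
Qed.

Lemma sup_lattice A B M : is_lattice A -> is_lattice B -> zmod_closed [in M] ->
  A `<=` M -> M `<=` B -> is_lattice M.
Proof.
move=> lA lB zM AM MB; apply: sub_lattice lB zM MB _ => x.
by have [m m0 /AM] := lattice_full x lA; exists m.
Qed.

Lemma lattice_nat L : is_lattice L -> exists2 m : nat, (0 < m)%N & L m%:R.
Proof. exact: lattice_full. Qed.

(** With [m] a positive integer in [J], the colon lies in [m^-1 I]; it is full because [x J] is
    finitely generated. *)
Lemma colon_lattice I J : natunits K -> is_lattice I -> is_lattice J ->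
  is_lattice (colon I J).
Proof.
move=> uK lI lJ; have zI := lattice_zmod lI.
have [m m0 Jm] := lattice_nat lJ.
apply: (@sub_lattice (scale (m%:R)^-1 I)).
- by apply: scale_lattice => //; rewrite unitrV; exact: uK.
- exact: colon_zmod.
- move=> x Hx; apply/mem_scale; first by rewrite unitrV; exact: uK.
  by rewrite invrK mulrC; exact: Hx.
move=> x; have [n n0 Hn] : exists2 n : nat, (0 < n)%N & forall y, J y -> I (x * (y *+ n)).
  have fI y : exists2 n : nat, (0 < n)%N & I (x * (y *+ n)).
    by have [n n0] := lattice_full (x * y) lI; rewrite -mulrnAr; exists n.
  apply: (@lattice_absorb J [set y | I (x * y)]) => //; exact: zmod_preimage.
by exists n => // y Jy; rewrite mulrnAl -mulrnAr; exact: Hn.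
Qed.

Lemma colon_order I : natunits K -> is_lattice I -> is_order (colon I I).
Proof.
move=> uK lI; apply: orderP; first exact: colon_lattice.
- by apply: colon_zmod; exact: lattice_zmod.
- exact: colon_self1.
- exact: colon_self_mul.
Qed.

End Lattices.

(** * Norms and Diophantine approximation *)

Section FieldNorm.
Import VectorInternalTheory.
Context {L : fieldExtType rat}.
Implicit Types x y : L.

(** The matrix of multiplication by [x], acting on row vectors; hence the reversed order in
    [regmxM]. *)
Definition regmx x : 'M[rat]_(dim L) := lin1_mx (v2r \o amull x \o r2v).

Lemma regmxE x y : v2r y *m regmx x = v2r (x * y).
Proof. by rewrite mul_rV_lin1 /= v2rK lfunE. Qed.

Lemma regmx_eq (M N : 'M[rat]_(dim L)) :
  (forall y : L, v2r y *m M = v2r y *m N) -> M = N.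
Proof.
by move=> E; apply/row_matrixP => i; rewrite !rowE -[delta_mx 0 i]r2vK E.
Qed.

Lemma regmx1 : regmx 1 = 1%:M.
Proof. by apply: regmx_eq => y; rewrite regmxE mul1r mulmx1. Qed.

Lemma regmxM x y : regmx (x * y) = regmx y *m regmx x.
Proof. by apply: regmx_eq => z; rewrite mulmxA !regmxE mulrA. Qed.

Lemma regmxB x y : regmx (x - y) = regmx x - regmx y.
Proof.
by apply: regmx_eq => z; rewrite mulmxBr !regmxE mulrBl raddfB.
Qed.

Lemma regmx0 : regmx 0 = 0.
Proof. by rewrite -(subrr 0) regmxB subrr. Qed.

Lemma regmxZ (a : rat) x : regmx (a *: x) = a *: regmx x.
Proof.
by apply: regmx_eq => z; rewrite -scalemxAr !regmxE -scalerAl linearZ.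
Qed.

Lemma regmxD x y : regmx (x + y) = regmx x + regmx y.
Proof.
by apply: regmx_eq => z; rewrite mulmxDr !regmxE mulrDl raddfD.
Qed.

Lemma regmx_sum (I : finType) (v : I -> L) :
  regmx (\sum_i v i) = \sum_i regmx (v i).
Proof. exact: (big_morph regmx regmxD regmx0). Qed.

(** The norm of [L] over the rationals. *)
Definition fnorm x : rat := \det (regmx x).

Lemma fnorm1 : fnorm 1 = 1. Proof. by rewrite /fnorm regmx1 det1. Qed.

Lemma fnormM x y : fnorm (x * y) = fnorm x * fnorm y.
Proof. by rewrite /fnorm regmxM det_mulmx mulrC. Qed.

Lemma fnorm_neq0 x : x != 0 -> fnorm x != 0.
Proof.
move=> x0; apply/eqP => N0; have := fnorm1.
by rewrite -(divff x0) fnormM N0 mul0r => /eqP; rewrite eq_sym oner_eq0.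
Qed.

Lemma fnormZ (a : rat) x : fnorm (a *: x) = a ^+ dim L * fnorm x.
Proof. by rewrite /fnorm regmxZ detZ. Qed.

Lemma dim_fieldExt_gt0 : (0 < dim L)%N.
Proof. by rewrite -dimvf adim_gt0. Qed.

End FieldNorm.

Lemma det_bound (n : nat) (A : 'M[rat]_n) (e : rat) :
  (forall i j, `|A i j| <= e) -> `|\det A| <= n`!%:R * e ^+ n.
Proof.
move=> Ae; rewrite /determinant.
apply: le_trans (ler_norm_sum _ _ _) _.
rewrite -perm.card_Sn -sum1_card natr_sum mulr_suml; apply: ler_sum => s _.
rewrite mul1r normrM normrX normrN1 expr1n mul1r normr_prod.
rewrite -[n in e ^+ n]card_ord -prodr_const.
by apply: ler_prod => i _; rewrite normr_ge0 Ae.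
Qed.

(** Dirichlet's pigeonhole: the fractional parts of [T ^ k + 1] multiples of [q] fall into [T ^ k]
    boxes of side 1/T, and the difference of two multiples in one box gives [m]. *)
Lemma simultaneous_approx (k T : nat) (q : 'I_k -> rat) : (0 < T)%N ->
  exists2 m : nat, (0 < m <= T ^ k)%N &
  exists c : 'I_k -> int, forall j, `|q j *+ m - (c j)%:~R| <= T%:R^-1.
Proof.
move=> T0; pose fr (x : rat) : rat := x - (Num.floor x)%:~R.
have fr01 x : 0 <= fr x < 1.
  have /andP [h1 h2] := floor_itv x; rewrite /fr subr_ge0 h1 /=.
  by rewrite ltrBlDr addrC -[1 in X in _ < X]/(1%:~R) -intrD.
have Tp : 0 < T%:R :> rat by rewrite ltr0n.
have bx x : (`|Num.floor (T%:R * fr x)|%N < T)%N.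
  have /andP [f0 f1] := fr01 x.
  have p0 : 0 <= Num.floor (T%:R * fr x).
    by rewrite floor_ge0 mulr_ge0 // ltW.
  by rewrite -ltz_nat gez0_abs // floor_lt_int -pmulrn -[X in _ < X]mulr1 ltr_pM2l.
pose f (i : 'I_(T ^ k).+1) := [ffun j : 'I_k => Ordinal (bx (q j *+ i))].
have [i1 [i2 [ne12 fE]]] : exists i1 i2, i1 != i2 /\ f i1 = f i2.
  apply: contrapT => H; have /leq_card : injective f.
    move=> i1 i2 fE; apply/eqP; case: (eqVneq i1 i2) => // ne12.
    by case: H; exists i1, i2.
  by rewrite card_ffun !card_ord ltnn.
wlog lt12 : i1 i2 ne12 fE / (i1 < i2)%N.
  move=> W; have := ne12; rewrite -val_eqE /= neq_ltn => /orP [lt|lt].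
    exact: W lt.
  by apply: (W i2 i1) => //; rewrite eq_sym.
exists (i2 - i1)%N.
  by rewrite subn_gt0 lt12 (leq_trans (leq_subr _ _)) // -ltnS.
exists (fun j => Num.floor (q j *+ i2) - Num.floor (q j *+ i1)) => j.
have -> : q j *+ (i2 - i1) -
    (Num.floor (q j *+ i2) - Num.floor (q j *+ i1))%:~R =
    fr (q j *+ i2) - fr (q j *+ i1).
  by rewrite /fr mulrnBr ?(ltnW lt12) // intrB; ring.
have E : Num.floor (T%:R * fr (q j *+ i1)) = Num.floor (T%:R * fr (q j *+ i2)).
  have /ffunP/(_ j) := fE; rewrite !ffunE => /(congr1 val) /= E.
  have p0 x : 0 <= Num.floor (T%:R * fr x).
    by rewrite floor_ge0 mulr_ge0 ?(ltW Tp) //; have /andP [] := fr01 x.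
  by rewrite -[LHS]gez0_abs // -[RHS]gez0_abs // E.
have /andP [a1 a2] := floor_itv (T%:R * fr (q j *+ i1)).
have /andP [b1 b2] := floor_itv (T%:R * fr (q j *+ i2)).
rewrite E intrD in a1 a2; rewrite intrD in b2.
have close : `|T%:R * (fr (q j *+ i2) - fr (q j *+ i1))| <= 1.
  rewrite mulrBr ler_norml; apply/andP; split.
    rewrite lerBrDr addrC lerBlDr; apply: le_trans (ltW a2) _.
    by rewrite lerD2r.
  rewrite lerBlDr addrC; apply: le_trans (ltW b2) _.
  by rewrite lerD2r.
by rewrite -(ler_pM2l Tp) mulfV ?gt_eqF // -[T%:R]ger0_norm ?(ltW Tp) // -normrM.
Qed.

(** * Approximation by integral combinations, measured by the norm *)

Section FieldApprox.
Import VectorInternalTheory.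
Context {L : fieldExtType rat}.

(** The bound [M] does not depend on [x]: when the coordinates of [x *+ m] are close to integers,
    the remainder has a matrix with small entries, hence a small norm. *)
Lemma fnorm_approx (k : nat) (v : 'I_k -> L) :
  (forall x, exists q : 'I_k -> rat, x = \sum_i q i *: v i) ->
  exists M : nat, forall x : L, exists2 m : nat, (0 < m <= M)%N &
    exists c : 'I_k -> int, `|fnorm (x *+ m - \sum_i v i *~ c i)| < 1.
Proof.
move=> span; set n := dim L.
pose beta : rat := \sum_i \sum_a \sum_b `|regmx (v i) a b|.
have beta0 : 0 <= beta by do 3![apply: sumr_ge0 => ? _].
have c0 : 0 <= n`!%:R * (beta + 1) by rewrite mulr_ge0 ?addr_ge0.
(* With this [T] the entries are at most [beta / T <= 1], so the norm is at most
   [n! * (beta / T) ^ n]. As [n > 0], the power is at most [beta / T], and the product is below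
   1. *)
pose T := (Num.bound (n`!%:R * (beta + 1))).+1.
have bT : n`!%:R * (beta + 1) < T%:R.
  by apply: lt_trans (archi_boundP c0) _; rewrite ltr_nat.
have Tp : 0 < T%:R :> rat by rewrite ltr0n.
exists (T ^ k)%N => x; have [q xE] := span x.
have [m mT [c Hc]] := simultaneous_approx q (ltn0Sn _ : (0 < T)%N).
exists m => //; exists c.
have -> : x *+ m - \sum_i v i *~ c i = \sum_i (q i *+ m - (c i)%:~R) *: v i.
  rewrite xE -sumrMnl -sumrB; apply: eq_bigr => i _.
  by rewrite scalerBl scaler_int scalerMnl.
have ent a b : `|regmx (\sum_i (q i *+ m - (c i)%:~R) *: v i) a b| <= beta / T%:R.
  rewrite regmx_sum summxE /beta mulr_suml.
  apply: le_trans (ler_norm_sum _ _ _) _; apply: ler_sum => i _.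
  rewrite regmxZ mxE normrM mulrC; apply: ler_pM => //.
  rewrite (bigD1 a) //= (bigD1 b) //= -addrA lerDl addr_ge0 //.
    by apply: sumr_ge0.
  by do 2![apply: sumr_ge0 => ? _].
apply: le_lt_trans (det_bound ent) _.
have n1 : 1 <= n`!%:R :> rat by rewrite ler1n fact_gt0.
have bT' : beta + 1 < T%:R.
  by apply: le_lt_trans bT; rewrite ler_peMl ?addr_ge0.
have b1 : 0 <= beta / T%:R <= 1.
  rewrite divr_ge0 ?(ltW Tp) //= ler_pdivrMr // mul1r.
  by apply: ltW; apply: le_lt_trans bT'; rewrite lerDl.
have n0 : (0 < n)%N by exact: dim_fieldExt_gt0.
rewrite -/n -(prednK n0) exprS (prednK n0) mulrA.
apply: (@le_lt_trans _ _ (n`!%:R * (beta / T%:R) * 1)).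
  apply: ler_wpM2l; first by rewrite mulr_ge0 //; case/andP: b1.
  by case/andP: b1 => ? ?; exact: exprn_ile1.
rewrite mulr1 mulrA ltr_pdivrMr // mul1r; apply: le_lt_trans bT.
by rewrite ler_wpM2l // lerDl.
Qed.

End FieldApprox.

(** * Products of number fields *)

Section ProductOfFields.
Context {K : comUnitRingType} {n : nat} {F : 'I_n -> fieldExtType rat}.
Context {pr : forall i, {rmorphism K -> F i}}.
Hypothesis prP : forall y : (forall i, F i), exists! x : K, forall i, pr i x = y i.

Lemma pr_lift (y : forall i, F i) : exists x : K, forall i, pr i x = y i.
Proof. by have [x [Hx _]] := prP y; exists x. Qed.

Lemma pr_inj (x y : K) : (forall i, pr i x = pr i y) -> x = y.
Proof.
by move=> E; have [z [_ uz]] := prP (fun i => pr i y); rewrite -(uz x E) -(uz y).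
Qed.

Lemma pr_unit (x : K) : (forall i, pr i x != 0) -> x \is a GRing.unit.
Proof.
move=> x0; have [y Hy] := pr_lift (fun i => (pr i x)^-1).
apply/unitrP; exists y; have E : y * x = 1.
  by apply: pr_inj => i; rewrite rmorphM Hy rmorph1 mulVf // x0.
by split=> //; rewrite mulrC.
Qed.

Lemma fieldExt_nat_neq0 (L : fieldExtType rat) (m : nat) : (0 < m)%N -> m%:R != 0 :> L.
Proof.
by move=> m0; rewrite -scaler_nat scaler_eq0 oner_eq0 orbF pnatr_eq0 -lt0n.
Qed.

Lemma product_natunits : natunits K.
Proof. by move=> m m0; apply: pr_unit => i; rewrite rmorph_nat fieldExt_nat_neq0. Qed.

Lemma idempotent i (y : F i) : exists2 e : K, pr i e = y & forall j, j != i -> pr j e = 0.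
Proof.
have [e He] := pr_lift (@eqtype.dfwith _ (fun j => F j : Type) (fun j => 0) i y); exists e.
  by rewrite He dfwith_in.
by move=> j ji; rewrite He dfwith_out // eq_sym.
Qed.

End ProductOfFields.

Lemma full_family (K : comUnitRingType) (M : set K) (I : finType) (w : I -> K) :
  zmod_closed [in M] -> (forall x, exists2 m : nat, (0 < m)%N & M (x *+ m)) ->
  exists2 m : nat, (0 < m)%N & forall i, M (w i *+ m).
Proof.
move=> zM fM; pose f i := s2val (cid2 (fM (w i))).
exists (\prod_i f i)%N.
  by rewrite prodn_gt0 // => i; exact: (s2valP (cid2 (fM (w i)))).
move=> i; rewrite (bigD1 i) //= mulrnA; apply: zmodMn => //.
exact: (s2valP' (cid2 (fM (w i)))).
Qed.

(** * Elements of minimal norm in a lattice *)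

Section MinimalNorm.
Import VectorInternalTheory.
Context {K : comUnitRingType} {L : fieldExtType rat} (f : {rmorphism K -> L}).

(** A multiple of [I] acts by integral matrices, and these have integral determinants. *)
Lemma bounded_denominators (I : set K) : is_lattice I ->
  exists2 e : nat, (0 < e)%N & forall x, I x -> fnorm (f (x *+ e)) \is a Num.int.
Proof.
move=> lI; pose M : set K := [set x | forall a b, regmx (f x) a b \is a Num.int].
have zM : zmod_closed [in M].
  apply/zmodP; split=> [a b|x y Mx My a b].
    by rewrite rmorph0 regmx0 mxE rpred0.
  have -> : regmx (f (x - y)) a b = regmx (f x) a b - regmx (f y) a b.
    by rewrite rmorphB regmxB mxE; congr (_ + _); rewrite mxE.
  by have := My a b; have := Mx a b; exact: rpredB.
have [e e0 He] : exists2 e : nat, (0 < e)%N & forall x, I x -> M (x *+ e).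
  apply: lattice_absorb => // x.
  pose Z : set rat := [set q | q \is a Num.int].
  have zZ : zmod_closed [in Z].
    by apply/zmodP; split=> [|q r]; [exact: rpred0 | exact: rpredB].
  have fZ (q : rat) : exists2 m : nat, (0 < m)%N & Z (q *+ m).
    exists `|denq q|%N; first by rewrite absz_gt0 denq_neq0.
    rewrite /Z /= -mulr_natr -[X in _ * X]mulrz_nat natz gez0_abs ?denq_ge0 //.
    by rewrite -[q in q * _]divq_num_den mulfVK ?intr_eq0 ?denq_neq0 ?intr_int.
  have [m m0 Hm] := full_family (fun p : 'I_(dim L) * 'I_(dim L) => regmx (f x) p.1 p.2) zZ fZ.
  exists m => // a b; rewrite rmorphMn /= -scaler_nat regmxZ mxE mulr_natl.
  exact: (Hm (a, b)).
exists e => // x Ix; rewrite /fnorm /determinant.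
apply: rpred_sum => s _; rewrite rpredM ?rpred_sign //; apply: rpred_prod => i _.
exact: He.
Qed.

(** Up to the factor [e ^ dim L], the absolute norms are natural numbers, so a smallest one exists;
    a positive integer in [I] is a first candidate. *)
Lemma minimal_norm (I : set K) : is_lattice I ->
  exists a, [/\ I a, f a != 0 &
    forall b, I b -> f b != 0 -> `|fnorm (f a)| <= `|fnorm (f b)|].
Proof.
move=> lI; have [e e0 He] := bounded_denominators lI.
have e0' : e%:R != 0 :> rat by rewrite pnatr_eq0 -lt0n.
have NE x : fnorm (f (x *+ e)) = e%:R ^+ dim L * fnorm (f x).
  by rewrite rmorphMn /= -scaler_nat fnormZ.
pose P k := `[< exists2 a, I a & f a != 0 /\ `|fnorm (f (a *+ e))| = k%:R >].
have nat_norm a : I a -> `|fnorm (f (a *+ e))| = (`|Num.floor (fnorm (f (a *+ e)))|%N)%:R.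
  by move=> /He /floorK {1}<-; rewrite -intr_norm -abszE -pmulrn.
have exP : exists k, P k.
  have [m m0 Im] := lattice_nat lI.
  exists `|Num.floor (fnorm (f (m%:R *+ e)))|%N; apply/asboolP; exists m%:R => //.
  by rewrite rmorph_nat fieldExt_nat_neq0 ?nat_norm.
case: (ex_minnP exP) => k /asboolP [a Ia [fa0 aE]] kmin; exists a; split=> // b Ib fb0.
have : P `|Num.floor (fnorm (f (b *+ e)))|%N.
  by apply/asboolP; exists b => //; rewrite nat_norm.
move=> /kmin; rewrite -(ler_nat rat) -aE -nat_norm // !NE !normrM ler_pM2l //.
by rewrite normr_gt0 expf_neq0.
Qed.

(* A norm-Euclidean algorithm up to bounded denominators. *)
Lemma lattice_almost_principal (S : set K) : (forall y, exists x, f x = y) ->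
  is_order S ->
  exists2 D : nat, (0 < D)%N & forall I, is_fractional_ideal S I ->
    exists a, [/\ I a, f a != 0 &
      forall b, I b -> exists2 c, S c & f (b *+ D) = f (c * a)].
Proof.
move=> fsurj oS.
have zS := order_zmod oS.
(* Lifts to [K] of a basis of [L]; multiplied by [t] they lie in [S], and so does the approximating
   combination [s]. *)
pose w (j : 'I_(dim L)) := sval (cid (fsurj (r2v (delta_mx 0 j)))).
have wE j : f (w j) = r2v (delta_mx 0 j) by rewrite /w; case: cid.
have [t t0 St] := full_family w zS (fun x => lattice_full x (order_lattice oS)).
have t0' : t%:R != 0 :> rat by rewrite pnatr_eq0 -lt0n.
have [|M HM] := @fnorm_approx L _ (fun j => f (w j *+ t)).
  move=> x; exists (fun j => v2r x 0 j / t%:R).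
  rewrite -[LHS]v2rK [v2r x in LHS]row_sum_delta raddf_sum /=.
  apply: eq_bigr => j _; rewrite linearZ /= -wE rmorphMn /= -scaler_nat scalerA.
  by rewrite mulfVK.
(* The factorial is a common multiple of all the denominators [m <= M] that can occur. *)
exists M`!; first exact: fact_gt0.
move=> I [lI mI]; have [a [Ia fa0 amin]] := minimal_norm lI.
exists a; split=> // b Ib.
have [m /andP [m0 mM] [c Hc]] := HM (f b / f a).
pose s := \sum_j (w j *+ t) *~ c j.
have Ss : S s by apply: zmod_sum => // j _; exact: zmodMz.
have fs : f s = \sum_j f (w j *+ t) *~ c j.
  by rewrite rmorph_sum; apply: eq_bigr => j _; rewrite rmorphMz.
have E : f (b *+ m) = f (s * a).
  (* A remainder with nonzero image would have smaller norm than [a]. *)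
  apply/eqP; rewrite -subr_eq0 -rmorphB; apply: contraPT isT => y0.
  have Iy : I (b *+ m - s * a).
    apply: zmodB; first exact: lattice_zmod.
      by apply: zmodMn => //; exact: lattice_zmod.
    exact: (submodM mI).
  have := amin _ Iy y0.
  have -> : f (b *+ m - s * a) = (f b / f a *+ m - f s) * f a.
    by rewrite rmorphB rmorphMn rmorphM /= mulrBl mulrnAl mulfVK.
  rewrite fnormM normrM -[X in X <= _]mul1r ler_pM2r; last first.
    by rewrite normr_gt0 fnorm_neq0.
  by rewrite fs leNgt Hc.
have /dvdnP [k ->] : (m %| M`!)%N by apply: dvdn_fact; rewrite m0.
exists (s *+ k); first exact: zmodMn.
by rewrite mulnC mulrnA rmorphMn E mulrnAl rmorphMn.
Qed.

End MinimalNorm.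

(** * Finiteness of lattice classes *)

Lemma number_fields_natunits (K : comUnitRingType) :
  is_product_of_number_fields K -> natunits K.
Proof. by move=> [n [F [pr prP]]]; exact: product_natunits prP. Qed.

(** The elements [a i], one for each component, glue to a unit [u] of [K]. It need not lie in [I],
    but [u * w] is the sum of the [e i * a i], where [e i] in [S] is [w] times an idempotent. The
    multiplier is [w * P / u]; since [w] and [P] depend on [S] alone, so does [N]. *)
Lemma lattice_normal_form (K : comUnitRingType) (S : set K) :
  is_product_of_number_fields K -> is_order S ->
  exists2 N : nat, (0 < N)%N & forall I, is_fractional_ideal S I ->
    exists2 x, x \is a GRing.unit &
      scale N%:R S `<=` scale x I /\ scale x I `<=` S.
Proof.
move=> [n [F [pr prP]]] oS; have zS := order_zmod oS.
have uK := product_natunits prP.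
have [/= w w0 [e [eS eii eij]]] : exists2 w : nat, (0 < w)%N & exists e : 'I_n -> K,
    [/\ forall i, S (e i), forall i, pr i (e i) = w%:R &
        forall i j, j != i -> pr j (e i) = 0].
  have ide i : exists e : K, pr i e = 1 /\ forall j, j != i -> pr j e = 0.
    by have [e e1 e0] := idempotent prP (1 : F i); exists e.
  pose e i := sval (cid (ide i)).
  have eP i : pr i (e i) = 1 /\ forall j, j != i -> pr j (e i) = 0 := svalP (cid (ide i)).
  have [w w0 Sw] := full_family e zS (fun x => lattice_full x (order_lattice oS)).
  exists w => //; exists (fun i => e i *+ w); split=> // [i|i j ji].
    by rewrite rmorphMn; case: (eP i) => -> _.
  by rewrite rmorphMn; case: (eP i) => _ -> //; rewrite mul0rn.
have surj i y : exists x, pr i x = y.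
  by have [x <- _] := idempotent prP y; exists x.
pose D i := s2val (cid2 (lattice_almost_principal (surj i) oS)).
have D0 i : (0 < D i)%N by exact: s2valP (cid2 (lattice_almost_principal (surj i) oS)).
have DP i := s2valP' (cid2 (lattice_almost_principal (surj i) oS)).
pose P := (\prod_i D i)%N; have P0 : (0 < P)%N by rewrite prodn_gt0.
exists (w * w * P)%N; first by rewrite !muln_gt0 w0.
move=> I fI; have [lI mI] := fI.
pose a i := sval (cid (DP i I fI)).
have aP i : [/\ I (a i), pr i (a i) != 0 &
    forall b, I b -> exists2 c, S c & pr i (b *+ D i) = pr i (c * a i)].
  by rewrite /a; case: cid.
have [u uE] := pr_lift prP (fun i => pr i (a i)).
have uu : u \is a GRing.unit by apply: pr_unit prP _ _ => i; rewrite uE; case: (aP i).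
have uwP : (w * P)%:R \is a @GRing.unit K by rewrite uK // muln_gt0 w0.
have u0 i : pr i u != 0 by rewrite uE; case: (aP i).
have prV i : pr i u^-1 = (pr i u)^-1.
  apply: (mulfI (u0 i)); rewrite divff ?u0 //.
  by have := rmorphM (pr i) u u^-1; rewrite mulrV // rmorph1.
exists ((w * P)%:R * u^-1); first by rewrite unitrM uwP unitrV.
split=> [_ [y Sy <-]|_ [b Ib <-]].
  apply/mem_scale; first by rewrite unitrM uwP unitrV.
  have -> : ((w * P)%:R * u^-1)^-1 * ((w * w * P)%:R * y) = y * (u * w%:R).
    rewrite invrM ?unitrV // invrK (mulnAC w w P) (natrM K (w * P)).
    have -> : u / (w * P)%:R * ((w * P)%:R * w%:R * y) =
      (w * P)%:R / (w * P)%:R * (y * (u * w%:R)) by ring.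
    by rewrite mulrV // mul1r.
  apply: (submodM mI) => //.
  have -> : u * w%:R = \sum_i e i * a i.
    apply: (pr_inj prP) => j; rewrite rmorphM rmorph_nat rmorph_sum (bigD1 j) //=.
    rewrite big1 => [|i ij]; rewrite rmorphM; last by rewrite eij ?mul0r // eq_sym.
    by rewrite eii addr0 uE mulrC.
  apply: zmod_sum => [|i _]; first exact: lattice_zmod.
  by apply: (submodM mI) => //; case: (aP i).
have HcP i : exists2 c, S c & pr i (b *+ P) = pr i (c * u).
  have [_ _ /(_ b Ib) [c Sc cE]] := aP i; rewrite /P (bigD1 i) //=.
  exists (c *+ \prod_(j < n | j != i) D j); first exact: zmodMn.
  by rewrite mulrnA rmorphMn cE mulrnAl rmorphMn !rmorphM uE.
pose c i := s2val (cid2 (HcP i)).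
have Sc i : S (c i) := s2valP (cid2 (HcP i)).
have cE i : pr i (b *+ P) = pr i (c i * u) := s2valP' (cid2 (HcP i)).
have -> : (w * P)%:R / u * b = \sum_i e i * c i.
  apply: (pr_inj prP) => j; rewrite rmorph_sum (bigD1 j) //= big1 => [|i ij]; last first.
    by rewrite rmorphM eij ?mul0r // eq_sym.
  rewrite addr0 !(rmorphM (pr j)) rmorph_nat natrM eii prV -!mulrA; congr (_ * _).
  apply: (mulIf (u0 j)).
  have := cE j; rewrite rmorphM rmorphMn /= -mulr_natl => <-.
  by rewrite -mulrA (mulrAC _ (pr j b)) mulVf ?u0 // mul1r.
by apply: zmod_sum => // i _; exact: orderM.
Qed.

Lemma finite_lattice_classes (K : comUnitRingType) (S : set K) :
  is_product_of_number_fields K -> is_order S ->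
  exists2 X : set (set K), finite_set X & forall I, is_fractional_ideal S I ->
    exists2 x, x \is a GRing.unit & X (scale x I).
Proof.
move=> pK oS; have [N N0 HN] := lattice_normal_form pK oS.
have uK := number_fields_natunits pK; have lS := order_lattice oS.
exists [set M : set K | [/\ zmod_closed [in M], scale N%:R S `<=` M & M `<=` S]].
  by apply: finite_between => //; apply: scale_lattice => //; exact: uK.
move=> I fI; have [x ux [h1 h2]] := HN I fI; exists x => //; split=> //.
by apply: scale_zmod; case: fI => _ [].
Qed.

(** The class becomes an orbit under scaling, the form in which classes are compared from here
    on. *)
Lemma ideal_class (K : comUnitRingType) (S I : set K) : S 1 -> is_submodule S I ->
  [set idmul I b | b in principal_ideals S] =
  [set scale x I | x in [set x | x \is a GRing.unit]].
Proof.
move=> S1 mI; apply/seteqP; split=> [_ [_ [x ux <-] <-]|_ [x ux <-]].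
  by exists x => //; rewrite -(idmul_principal _ S1 mI).
by exists (scale x S); [exists x | rewrite idmul_principal].
Qed.

Lemma ideal_class_eq (K : comUnitRingType) (I J : set K) :
  [set scale x I | x in [set x | x \is a GRing.unit]] =
  [set scale x J | x in [set x | x \is a GRing.unit]] <->
  exists2 x, x \is a GRing.unit & I = scale x J.
Proof.
split=> [E|[x ux ->]].
  have : [set scale x I | x in [set x | x \is a GRing.unit]] I.
    by exists 1; rewrite ?scale1 //=; exact: unitr1.
  by rewrite E => -[x ux <-]; exists x.
apply/seteqP; split=> [_ [y uy <-]|_ [y uy <-]].
  by exists (y * x); rewrite ?scaleM //= unitrM uy.
exists (y * x^-1); first by rewrite /= unitrM uy unitrV.
by rewrite scaleM mulrVK.
Qed.

Lemma finite_Cl (K : comUnitRingType) (S : set K) :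
  is_product_of_number_fields K -> is_order S -> finite_set (Cl S).
Proof.
move=> pK oS; have [X fX HX] := finite_lattice_classes pK oS.
pose cl (I : set K) := [set scale x I | x in [set x | x \is a GRing.unit]].
apply: (@sub_finite_set _ _ [set cl I | I in X]); last exact: finite_image.
move=> _ [I [fI _] <-]; have [x ux XxI] := HX I fI.
exists (scale x I) => //; rewrite ideal_class; [|exact: order1|by case: fI].
by apply/ideal_class_eq; exists x.
Qed.

(* An order containing S is recovered as the multiplier ring of each of its
   rescalings. *)
Lemma finite_overorders (K : comUnitRingType) (S : set K) :
  is_product_of_number_fields K -> is_order S ->
  finite_set [set T | is_order T /\ S `<=` T].
Proof.
move=> pK oS; have [X fX HX] := finite_lattice_classes pK oS.
apply: (@sub_finite_set _ _ [set colon I I | I in X]); last exact: finite_image.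
move=> T [oT ST].
have [x ux XxT] := HX T (conj (order_lattice oT) (order_submod oT ST)).
exists (scale x T) => //; apply/seteqP; split=> [y Hy|y Ty _ [z Tz <-]].
  have /Hy : scale x T x by exists 1; [exact: order1 | rewrite mulr1].
  move=> /mem_scale-/(_ ux); rewrite mulrA mulrAC.
  by rewrite mulVr // mul1r.
by exists (y * z); [exact: orderM | ring].
Qed.

(** Maximality for inclusion is reached by maximizing the number of members of [X] below a
    member. *)
Lemma finite_maximal (T : choiceType) (X : set (set T)) (A : set T) :
  finite_set X -> X A ->
  exists M, [/\ X M, A `<=` M & forall B, X B -> M `<=` B -> B = M].
Proof.
move=> fX XA; pose below M := X `&` [set B | B `<=` M].
have fb M : finite_set (below M) by exact: finite_setIl.
have [M [XM AM Mmax]] : exists M, [/\ X M, A `<=` M &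
    forall B, X B -> A `<=` B -> (ncard (below B) <= ncard (below M))%N].
  apply: contrapT => H.
  have : exists B, [/\ X B, A `<=` B & (ncard X < ncard (below B))%N].
    elim: (ncard X) => [|k [B [XB AB kB]]].
      exists A; split=> //; rewrite lt0n; apply/eqP => c0.
      by have := @ncardD1 _ (below A) A (fb A) (conj XA (@subset_refl _ A)); rewrite c0.
    apply: contrapT => H2; apply: H; exists B; split=> // C XC AC.
    rewrite leqNgt; apply/negP => lt; apply: H2; exists C; split=> //.
    exact: leq_trans lt.
  move=> [B [_ _]]; rewrite ltnNge => /negP; apply.
  by rewrite /ncard; apply: fsubset_leq_card; rewrite -fset_set_sub //; apply: subIsetl.
exists M; split=> // B XB MB; apply: contrapT => BM.
have bMB : below M `<=` below B by move=> C [XC CM]; split=> //; exact: subset_trans CM MB.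
have := Mmax B XB (subset_trans AM MB); rewrite (ncardD1 (fb B) (conj XB (@subset_refl _ B))).
rewrite ltnNge => /negP; apply.
rewrite /ncard; apply: fsubset_leq_card; rewrite -fset_set_sub //; last exact: finite_setD.
move=> C [XC CM]; split; first by split=> //; exact: subset_trans CM MB.
by move=> CB; apply: BM; apply/seteqP; split=> //; rewrite -CB.
Qed.

Lemma integral_relation (K : comUnitRingType) (x : K) : max_order x ->
  exists d (c : nat -> int), x ^+ d = - \sum_(i < d) x ^+ i *~ c i.
Proof.
move=> [p pm px]; pose d := (size p).-1.
have sp : size p = d.+1 by rewrite /d prednK // size_poly_gt0 monic_neq0.
exists d, (fun i => p`_i); apply/eqP; rewrite -addr_eq0; apply/eqP; move: px.
rewrite /root /map_poly horner_poly sp big_ord_recr /= => /eqP E; rewrite -[RHS]E.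
have -> : p`_d = 1 by move: pm; rewrite monicE lead_coefE => /eqP.
by rewrite mul1r addrC; congr (_ + _); apply: eq_bigr => i _; rewrite mulrzl.
Qed.

(** The new order is [M[x]], generated by the products of generators of [M] with [x ^ k] for
    [k < d], as the integral relation rewrites [x ^ d]. *)
Lemma adjoin_integral (K : comUnitRingType) (M : set K) (x : K) :
  is_order M -> max_order x -> exists N, [/\ is_order N, M `<=` N & N x].
Proof.
move=> oM /integral_relation [d [c xd]].
have zM := order_zmod oM; have lM := order_lattice oM.
have d0 : (0 < d)%N.
  rewrite lt0n; apply/eqP => d0; move: xd; rewrite d0 big_ord0 oppr0 expr0.
  by move/eqP; rewrite oner_eq0.
have [[s Ms] _] := lM.
pose N := zspan [set` [seq y * x ^+ k | y <- s, k <- iota 0 d]].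
have zN : zmod_closed [in N] by exact: zspan_zmod.
have MxN y k : M y -> (k < d)%N -> N (y * x ^+ k).
  move=> My kd; rewrite mulrC; move: y My; rewrite Ms; apply: zspan_sub.
    exact: (zmod_preimage _ zN).
  move=> y ys /=; rewrite mulrC; apply: sub_zspan => /=.
  by apply/allpairsP; exists (y, k); rewrite mem_iota.
have N_ind (P : set K) : zmod_closed [in P] ->
    (forall y k, M y -> (k < d)%N -> P (y * x ^+ k)) -> N `<=` P.
  move=> zP HP; apply: zspan_sub => // z /= /allpairsP [[y k] /= [ys]].
  rewrite mem_iota => kd ->; apply: HP => //.
  by rewrite Ms; exact: sub_zspan.
have MN : M `<=` N by move=> y My; rewrite -[y]mulr1 -(expr0 x); exact: MxN.
have xN z : N z -> N (x * z).
  move: z; apply: N_ind; first exact: zmod_preimage.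
  move=> y k My kd; rewrite /= mulrCA -exprS.
  have [kd'|] := ltnP k.+1 d; first exact: MxN.
  move=> dk; have -> : k.+1 = d by apply/eqP; rewrite eqn_leq dk kd.
  rewrite xd mulrN mulr_sumr; apply: (zmodN zN); apply: (zmod_sum _ zN) => i _.
  by rewrite -mulrzr mulrA mulrzr; apply: (zmodMz _ zN); exact: MxN.
have yN y z : M y -> N z -> N (y * z).
  move=> My; move: z; apply: N_ind; first exact: zmod_preimage.
  by move=> t k Mt kd; rewrite /= mulrA; apply: MxN => //; exact: orderM.
have xkN k z : N z -> N (x ^+ k * z).
  by move=> Nz; elim: k => [|k IH]; rewrite ?expr0 ?mul1r // exprS -mulrA; exact: xN.
exists N; split=> //; last by rewrite -[x]mulr1; apply: xN; apply: MN; exact: order1.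
apply: orderP => //.
- split; first by exists [seq y * x ^+ k | y <- s, k <- iota 0 d].
  by move=> y; have [m m0 /MN] := lattice_full y lM; exists m.
- by apply: MN; exact: order1.
move=> t z Nt Nz; rewrite mulrC; move: t Nt; apply: N_ind; first exact: zmod_preimage.
by move=> y k My kd; rewrite /= mulrC -mulrA; apply: yN => //; exact: xkN.
Qed.

(** A maximal member [M] among the finitely many overorders absorbs each integral [x], because
    [M[x]] is again an overorder. *)
Lemma max_order_bounded (K : comUnitRingType) (S : set K) :
  is_product_of_number_fields K -> is_order S ->
  exists M, [/\ is_order M, S `<=` M & max_order `<=` M].
Proof.
move=> pK oS.
have [M [[oM SM] _ Mmax]] :=
  finite_maximal (finite_overorders pK oS) (conj oS (@subset_refl _ S)).
exists M; split=> // x Ox; have [N [oN MN Nx]] := adjoin_integral oM Ox.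
by rewrite -(Mmax N) //; split=> //; exact: subset_trans SM MN.
Qed.

(** * Invertible ideals and the class number ratio *)

Section MaximalIdeals.
Context {K : comUnitRingType}.
Implicit Types (S T L I J P Q : set K).

Lemma ideal_submod S I : is_ideal S I -> is_submodule S I. Proof. by case. Qed.

Lemma ideal_zmod S I : is_ideal S I -> zmod_closed [in I]. Proof. by move=> [[]]. Qed.

Lemma max_ideal S P : is_maximal_ideal S P -> is_ideal S P. Proof. by case. Qed.

Lemma max_zmod S P : is_maximal_ideal S P -> zmod_closed [in P].
Proof. by move=> /max_ideal/ideal_zmod. Qed.

Lemma max_sub S P : is_maximal_ideal S P -> P `<=` S.
Proof. by move=> [[]]. Qed.

Lemma max_mul S P x y : is_maximal_ideal S P -> S x -> P y -> P (x * y).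
Proof. by move=> /max_ideal/ideal_submod; exact: submodM. Qed.

Lemma ideal_eq1 S I : is_ideal S I -> I 1 -> I = S.
Proof.
move=> [mI IS] I1; apply/seteqP; split=> // x Sx.
by rewrite -[x]mulr1; exact: submodM mI Sx I1.
Qed.

Lemma max_not1 S P : is_maximal_ideal S P -> ~ P 1.
Proof. by move=> [iP PS _] P1; apply: PS; exact: ideal_eq1. Qed.

Definition setadd I J : set K := [set x | exists2 y, J y & I (x - y)].

Lemma setadd_submod S I J : is_submodule S I -> is_submodule S J ->
  is_submodule S (setadd I J).
Proof.
move=> [zI mI] [zJ mJ]; split.
  apply/zmodP; split; first by exists 0; rewrite ?subr0; exact: zmod0.
  move=> x y [a Ja Ia] [b Jb Ib]; exists (a - b); first exact: zmodB.
  by rewrite (_ : _ - _ = x - a - (y - b)); [exact: zmodB | ring].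
move=> a x Sa [y Jy Ixy]; exists (a * y); first exact: mJ.
by rewrite -mulrBr; exact: mI.
Qed.

Lemma setaddl I J : zmod_closed [in J] -> I `<=` setadd I J.
Proof. by move=> zJ x Ix; exists 0; rewrite ?subr0 //; exact: zmod0. Qed.

Lemma setaddr I J : zmod_closed [in I] -> J `<=` setadd I J.
Proof. by move=> zI x Jx; exists x; rewrite ?subrr //; exact: zmod0. Qed.

Lemma setadd_sub I J M : zmod_closed [in M] -> I `<=` M -> J `<=` M ->
  setadd I J `<=` M.
Proof.
by move=> zM IM JM x [y /JM My /IM Mxy]; rewrite -(subrK y x); exact: zmodD.
Qed.

Lemma setadd_ideal S I J : is_ideal S I -> is_ideal S J -> zmod_closed [in S] ->
  is_ideal S (setadd I J).
Proof.
move=> [mI IS] [mJ JS] zS; split; first exact: setadd_submod.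
exact: setadd_sub.
Qed.

Lemma max_comax S P I : is_order S -> is_maximal_ideal S P -> is_ideal S I ->
  ~ (I `<=` P) -> exists2 x, I x & P (1 - x).
Proof.
move=> oS mP iI IP; have [iP _ Pmax] := mP.
have [E|E] := Pmax _ (setadd_ideal iP iI (order_zmod oS)) (setaddl (ideal_zmod iI)).
  by case: IP => x Ix; rewrite -E; apply: setaddr => //; exact: ideal_zmod iP.
have : setadd P I 1 by rewrite E; exact: order1.
by move=> [x Ix P1x]; exists x.
Qed.

Lemma scale_ideal S x : is_order S -> S x -> is_ideal S (scale x S).
Proof.
move=> oS Sx; split.
  by apply: scale_submod; exact: order_submod.
by move=> _ [y Sy <-]; exact: orderM.
Qed.

Lemma max_inv S P x : is_order S -> is_maximal_ideal S P -> S x -> ~ P x ->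
  exists2 y, S y & P (1 - x * y).
Proof.
move=> oS mP Sx Px; have [|_ [y Sy <-] H] := max_comax oS mP (scale_ideal oS Sx).
  by move=> H; apply/Px/H; exists 1; rewrite ?mulr1 //; exact: order1.
by exists y.
Qed.

Lemma max_prime S P x y : is_order S -> is_maximal_ideal S P -> S x -> S y ->
  P (x * y) -> P x \/ P y.
Proof.
move=> oS mP Sx Sy Pxy; have [Px|nPx] := pselect (P x); [by left | right].
have [z Sz Pz] := max_inv oS mP Sx nPx.
have -> : y = y * (1 - x * z) + z * (x * y) by ring.
by apply: zmodD; [exact: max_zmod mP | exact: max_mul mP Sy Pz | exact: max_mul mP Sz Pxy].
Qed.

Lemma max_sub_eq S P Q : is_maximal_ideal S P -> is_maximal_ideal S Q ->
  P `<=` Q -> P = Q.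
Proof. by move=> [_ _ Pmax] [iQ QS _] PQ; case: (Pmax Q iQ PQ). Qed.

Definition unit_mod T L x : Prop := T x /\ exists2 y, T y & L (1 - x * y).

(* T/L is semilocal with at most the two maximal ideals P and Q. *)
Definition units_outside T L P Q : Prop :=
  [/\ is_maximal_ideal T P, is_maximal_ideal T Q &
      forall x, T x -> ~ P x -> ~ Q x -> unit_mod T L x].

(** Invertible ideals over a semilocal ring are principal. It is enough to find a product [x * y]
    outside [P] and [Q], since it is then a unit modulo [L], whose inverse is absorbed into [y]. *)
Lemma invertible_locally_principal T L P Q I J : is_order T ->
  units_outside T L P Q -> is_submodule T I -> is_submodule T J ->
  idmul I J = T ->
  exists x y, [/\ I x, J y & L (1 - x * y)].
Proof.
move=> oT [mP mQ unitPQ] mI mJ IJ.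
suff [x [y [Ix Jy Pxy Qxy]]] : exists x y, [/\ I x, J y, ~ P (x * y) & ~ Q (x * y)].
  have Txy : T (x * y) by rewrite -IJ; exact: mem_idmul.
  have [_ [z Tz Lz]] := unitPQ _ Txy Pxy Qxy.
  exists x, (z * y); split=> //; first exact: submodM mJ _ _.
  by rewrite (_ : x * (z * y) = x * y * z); [|ring].
have outside M : is_maximal_ideal T M -> exists x y, [/\ I x, J y & ~ M (x * y)].
  move=> mM; apply: contrapT => H; apply: (max_not1 mM).
  suff : T `<=` M by apply; exact: order1.
  rewrite -IJ; apply: idmul_sub; first exact: max_zmod mM.
  by move=> x y Ix Jy; apply: contrapT => nM; apply: H; exists x, y.
have [a [b [Ia Jb Pab]]] := outside P mP.
have [PQ|PQ] := pselect (P `<=` Q).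
  have E := max_sub_eq mP mQ PQ.
  by exists a, b; rewrite -E.
have [c [d [Ic Jd Qcd]]] := outside Q mQ.
(* Chinese remaindering: [(1 - e) * a + e * c] is [a] modulo [P I] and [c] modulo [Q I]. *)
have [e Pe Qe] := max_comax oT mQ (max_ideal mP) PQ.
have zI := submod_zmod mI; have zJ := submod_zmod mJ.
have Te : T e by exact: max_sub mP _ Pe.
have T1e : T (1 - e) by exact: max_sub mQ _ Qe.
have TIJ x y : I x -> J y -> T (x * y) by rewrite -IJ; exact: mem_idmul.
have Ix : I ((1 - e) * a + e * c) by apply: zmodD => //; exact: submodM mI _ _.
have Jy : J ((1 - e) * b + e * d) by apply: zmodD => //; exact: submodM mJ _ _.
exists ((1 - e) * a + e * c), ((1 - e) * b + e * d); split=> //.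
  move=> H; apply: Pab.
  have -> : a * b = ((1 - e) * a + e * c) * ((1 - e) * b + e * d)
     - ((c - a) * b + a * (d - b) + e * (c - a) * (d - b)) * e by ring.
  apply: zmodB (max_zmod mP) H _; apply: max_mul mP _ Pe.
  have zT := order_zmod oT.
  have Ica : I (c - a) by exact: zmodB.
  have Jdb : J (d - b) by exact: zmodB.
  apply: zmodD => //; first by apply: zmodD => //; exact: TIJ.
  by rewrite -mulrA; apply: orderM => //; exact: TIJ.
move=> H; apply: Qcd.
have -> : c * d = ((1 - e) * a + e * c) * ((1 - e) * b + e * d)
   - ((a - c) * d + c * (b - d) + (1 - e) * (a - c) * (b - d)) * (1 - e) by ring.
apply: zmodB (max_zmod mQ) H _; apply: max_mul mQ _ Qe.
have zT := order_zmod oT.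
have Iac : I (a - c) by exact: zmodB.
have Jbd : J (b - d) by exact: zmodB.
apply: zmodD => //; first by apply: zmodD => //; exact: TIJ.
by rewrite -mulrA; apply: orderM => //; exact: TIJ.
Qed.

Definition spanmod S L x : set K := [set z | exists2 s, S s & L (z - s * x)].

Lemma spanmod_submod S L x : is_order S -> is_submodule S L ->
  is_submodule S (spanmod S L x).
Proof.
move=> oS [zL mL]; have zS := order_zmod oS; split.
  apply/zmodP; split; first by exists 0; rewrite ?mul0r ?subr0; exact: zmod0.
  move=> y z [s Ss Ls] [t St Lt]; exists (s - t); first exact: zmodB.
  by rewrite (_ : _ - _ = y - s * x - (z - t * x)); [exact: zmodB | ring].
move=> a y Sa [s Ss Ls]; exists (a * s); first exact: orderM.
by rewrite -mulrA -mulrBr; exact: mL.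
Qed.

Lemma spanmod_sub S L x M : is_submodule S M -> L `<=` M -> M x ->
  spanmod S L x `<=` M.
Proof.
move=> mM LM Mx y [s Ss /LM Ms]; rewrite -(subrK (s * x) y).
by apply: zmodD => //; [exact: submod_zmod mM | exact: submodM mM _ _].
Qed.

Lemma sub_spanmod S L x : zmod_closed [in S] -> L `<=` spanmod S L x.
Proof. by move=> zS y Ly; exists 0; rewrite ?mul0r ?subr0 //; exact: zmod0. Qed.

Lemma mem_spanmod S L x : S 1 -> zmod_closed [in L] -> spanmod S L x x.
Proof. by move=> S1 zL; exists 1; rewrite ?mul1r ?subrr //; exact: zmod0. Qed.

End MaximalIdeals.

(** * Double counting of invertible ideals over [S] and [T] *)

Section ClassNumberRatio.
Context {K : comUnitRingType} (S T L P Q : set K).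
Hypotheses (oS : is_order S) (oT : is_order T).
Hypotheses (ST : S `<=` T) (lL : is_lattice L) (LS : is_maximal_ideal S L).
Hypotheses (LT : is_submodule T L) (PQ : units_outside T L P Q).
Implicit Types (I J : set K).

Let zS : zmod_closed [in S] := order_zmod oS.
Let zT : zmod_closed [in T] := order_zmod oT.
Let zL : zmod_closed [in L] := lattice_zmod lL.
Let LsubS : L `<=` S := max_sub LS.
Let mTS : is_submodule S T := order_submod oT ST.
Let mSS : is_submodule S S := order_submod oS (@subset_refl _ S).
Let mTT : is_submodule T T := order_submod oT (@subset_refl _ T).
Let mLS : is_submodule S L := submod_sub ST LT.
Let LTL : idmul L T = L. Proof. by rewrite idmulC idmul1 //; exact: order1. Qed.
Let TST : idmul S T = T. Proof. by rewrite idmul1 //; exact: order1. Qed.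

(** This gives surjectivity of the map from invertible [S]-ideals to invertible [T]-ideals. The
    inverse of [S x + L J] is [S x' + L J']: all products other than [x * x'] fall into [L], because
    [L T = L]. *)
Lemma lift_invertible J J' x x' : is_fractional_ideal T J ->
  is_fractional_ideal T J' -> idmul J J' = T -> J x -> J' x' -> L (1 - x * x') ->
  let I := spanmod S (idmul L J) x in invertible_ideals S I /\ idmul I T = J.
Proof.
have frac A y : is_fractional_ideal T A -> A y ->
    is_fractional_ideal S (spanmod S (idmul L A) y).
  move=> [lA mA] Ay; have mLA : is_submodule T (idmul L A) by exact: idmul_submod.
  have mA' := submod_sub ST mA.
  have LAA : idmul L A `<=` A.
    apply: idmul_sub; first exact: lattice_zmod.
    by move=> a b /LsubS/ST; exact: submodM mA.
  split; last by apply: spanmod_submod => //; exact: submod_sub ST mLA.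
  apply: (@sup_lattice _ (idmul L A) A) => //.
  - exact: idmul_lattice.
  - by apply: submod_zmod; apply: (spanmod_submod _ oS); exact: submod_sub ST mLA.
  - exact: sub_spanmod.
  - exact: spanmod_sub.
have absorb A B a b : idmul A B = T -> A a -> idmul L B b -> L (a * b).
  move=> AB Aa LBb; rewrite -LTL -AB idmulA (idmulC L) -idmulA.
  exact: mem_idmul.
move=> fJ fJ' JJ' Jx J'x' Lx I; have [lJ mJ] := fJ; have [lJ' mJ'] := fJ'.
have J'J : idmul J' J = T by rewrite idmulC.
have LJJ : idmul L J `<=` J.
  apply: idmul_sub; first exact: lattice_zmod.
  by move=> a b /LsubS/ST; exact: submodM mJ.
have LJI : idmul L J `<=` I by exact: sub_spanmod.
have LJI' : idmul L J' `<=` spanmod S (idmul L J') x' by exact: sub_spanmod.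
have Ix : I x by apply: mem_spanmod; [exact: order1 | exact: idmul_zmod].
have Ix' : spanmod S (idmul L J') x' x'.
  by apply: mem_spanmod; [exact: order1 | exact: idmul_zmod].
have fI : is_fractional_ideal S I by exact: frac.
have fI' := frac _ _ fJ' J'x'.
have Sxx : S (x * x').
  by rewrite -[x * x'](subKr 1); apply: zmodB => //; [exact: order1 | exact: LsubS].
have TJJ a b : J a -> J' b -> T (a * b) by rewrite -JJ'; exact: mem_idmul.
have mLJ : is_submodule T (idmul L J) by exact: idmul_submod.
split; last first.
  apply/seteqP; split.
    apply: idmul_sub; first exact: lattice_zmod.
    move=> a t Ia Tt; rewrite mulrC; apply: (submodM mJ) => //.
    by move: a Ia; apply: spanmod_sub => //; exact: submod_sub ST mJ.
  move=> j Jj; have -> : j = x * (j * x') + (1 - x * x') * j * 1 by ring.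
  apply: (zmodD (@idmul_zmod _ _ _)).
    by apply: mem_idmul => //; exact: TJJ.
  by apply: mem_idmul; [apply: LJI; exact: mem_idmul | exact: order1].
split=> //; exists (spanmod S (idmul L J') x') => //.
apply/seteqP; split.
  apply: idmul_sub => // a b [s Ss Ha] [t St Hb].
  have -> : a * b = s * t * (x * x') + s * (x * (b - t * x')) + t * (x' * (a - s * x))
     + (a - s * x) * (b - t * x') by ring.
  apply: zmodD => //; last by apply/LsubS/(absorb _ _ _ _ JJ') => //; exact: LJJ.
  apply: zmodD => //; last first.
    by apply: orderM => //; apply: LsubS; exact: (absorb _ _ _ _ J'J).
  apply: zmodD => //; first by apply: orderM => //; exact: orderM.
  by apply: orderM => //; apply: LsubS; exact: (absorb _ _ _ _ JJ').
have mII' : is_submodule S (idmul I (spanmod S (idmul L J') x')).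
  by apply: idmul_submod; case: fI.
have LII' : L `<=` idmul I (spanmod S (idmul L J') x').
  rewrite -[X in X `<=` _]LTL -JJ' idmulA; apply: idmul_sub; first exact: idmul_zmod.
  move=> a j LJa J'j.
  have -> : a * j = (x * j * a) * x' + a * ((1 - x * x') * j) by ring.
  apply: (zmodD (@idmul_zmod _ _ _)).
    apply: mem_idmul => //; apply: LJI; apply: (submodM mLJ) => //; exact: TJJ.
  by apply: mem_idmul; [exact: LJI | apply: LJI'; exact: mem_idmul].
move=> s Ss; rewrite -[s]mulr1; apply: (submodM mII') => //.
have -> : 1 = x * x' + (1 - x * x') by ring.
apply: (zmodD (@idmul_zmod _ _ _)).
  exact: mem_idmul.
exact: LII'.
Qed.

(** Each of these ideals stands for one element of the quotient group (T/L)^x / (S/L)^x. *)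
Definition unit_spans : set (set K) := [set spanmod S L u | u in unit_mod T L].

Lemma finite_unit_spans : finite_set unit_spans.
Proof.
apply: sub_finite_set (finite_between lL (order_lattice oT)).
move=> _ [u [Tu _] <-]; split.
- exact: submod_zmod (spanmod_submod _ oS mLS).
- exact: sub_spanmod.
- by apply: spanmod_sub => //; move=> y /LsubS/ST.
Qed.

Lemma order_fractional (A : set K) : is_order A -> is_fractional_ideal A A.
Proof. by move=> oA; split; [exact: order_lattice | exact: order_submod]. Qed.

(** Since [S/L] is a field, an invertible [I] is generated modulo [L] by one element [x]; extending
    to [T] shows that [x] is a unit modulo [L]. *)
Lemma unit_span_kernel I : unit_spans I <-> invertible_ideals S I /\ idmul I T = T.
Proof.
have fT := order_fractional oT.
split=> [[u [Tu [v Tv Lv]] <-]|].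
  have -> : spanmod S L u = spanmod S (idmul L T) u by rewrite LTL.
  exact: (lift_invertible fT fT (idmul_order oT) Tu Tv Lv).
move=> [[[lI mI] [J [lJ mJ] IJ]] IT].
have LL : units_outside S L L L.
  by split=> // x Sx Lx _; have [y Sy Ly] := max_inv oS LS Sx Lx; split=> //; exists y.
have [x [y [Ix Jy Lxy]]] := invertible_locally_principal oS LL mI mJ IJ.
have IsubT : I `<=` T by rewrite -IT => z Iz; rewrite -[z]mulr1; apply: mem_idmul => //; exact: order1.
(* [L = L T = L I T = I L], by [I T = T] and [L T = L]. *)
have LI : L `<=` I.
  rewrite -[X in X `<=` _]LTL -IT idmulA (idmulC L I) -idmulA LTL.
  by apply: idmul_sub; [exact: lattice_zmod | move=> a b Ia /LsubS Sb; rewrite mulrC; exact: submodM mI Sb Ia].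
have IE : I = spanmod S L x.
  apply/seteqP; split; last exact: spanmod_sub.
  move=> b Ib; exists (b * y); first by rewrite -IJ; exact: mem_idmul.
  rewrite (_ : _ - _ = b * (1 - x * y)); last by ring.
  by apply: (submodM LT) => //; exact: IsubT.
exists x => //; split; first exact: IsubT.
(* These are the elements congruent modulo [L] to multiples of [x]; containing [I T = T], they
   contain 1. *)
suff : idmul I T `<=` [set z | exists2 t, T t & L (z - x * t)].
  by rewrite IT => /(_ 1 (order1 oT)).
apply: idmul_sub.
  apply/zmodP; split; first by exists 0; rewrite ?mulr0 ?subrr; exact: zmod0.
  move=> a b [t Tt La] [t' Tt' Lb]; exists (t - t'); first exact: zmodB.
  by rewrite (_ : _ - _ = a - x * t - (b - x * t')); [exact: zmodB | ring].
move=> a t; rewrite {1}IE => -[s Ss Ls] Tt; exists (s * t).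
  by apply: orderM => //; exact: ST.
rewrite (_ : _ - _ = t * (a - s * x)); last by ring.
exact: submodM LT Tt Ls.
Qed.

Let cl I : set (set K) := [set scale x I | x in [set x | x \is a GRing.unit]].

Lemma ClE (A : set K) : is_order A -> Cl A = [set cl I | I in invertible_ideals A].
Proof.
move=> oA; apply/seteqP; split=> [_ [I iI <-]|_ [I iI <-]].
  exists I => //; rewrite ideal_class //; [exact: order1 | by case: iI => [[]]].
by exists I => //; rewrite ideal_class //; [exact: order1 | case: iI => [[]]].
Qed.

Lemma invertible_scale (A I : set K) x : x \is a GRing.unit -> is_order A ->
  invertible_ideals A I -> invertible_ideals A (scale x I).
Proof.
move=> ux oA [[lI mI] [J [lJ mJ] IJ]]; split.
  by split; [exact: scale_lattice | exact: scale_submod].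
exists (scale x^-1 J).
  by split; [apply: scale_lattice; rewrite ?unitrV | exact: scale_submod].
by rewrite idmul_scale idmulC idmul_scale scaleVK // idmulC.
Qed.

Lemma invertible_mul I J : invertible_ideals S I -> invertible_ideals S J ->
  invertible_ideals S (idmul I J).
Proof.
move=> [[lI mI] [I' [lI' mI'] II']] [[lJ mJ] [J' [lJ' mJ'] JJ']].
split; first by split; [exact: idmul_lattice | exact: idmul_submod].
exists (idmul I' J'); first by split; [exact: idmul_lattice | exact: idmul_submod].
rewrite -idmulA (idmulA J) (idmulC J I') -(idmulA I' J) JJ' (idmulC I' S).
by rewrite (idmul1 (order1 oS) mI').
Qed.

Lemma invertible_extend I : invertible_ideals S I -> invertible_ideals T (idmul I T).
Proof.
have lT := order_lattice oT.
have f A : is_lattice A -> is_fractional_ideal T (idmul A T).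
  by move=> lA; split; [exact: idmul_lattice | rewrite idmulC; exact: idmul_submod].
move=> [[lI mI] [J [lJ mJ] IJ]]; split; first exact: f.
exists (idmul J T); first exact: f.
by rewrite (idmulC J) -idmulA (idmulA T T) idmul_order // (idmulC T J) idmulA IJ.
Qed.

Lemma idmul_cancel (I A B : set K) : invertible_ideals S I ->
  is_submodule S A -> is_submodule S B -> idmul I A = idmul I B -> A = B.
Proof.
move=> [_ [J _ IJ]] mA mB E; rewrite -(idmul1 (order1 oS) mA) -(idmul1 (order1 oS) mB).
by rewrite -IJ (idmulC I J) -!idmulA E.
Qed.

Lemma units_scale (A I : set K) z : is_submodule A I -> units A z -> scale z I = I.
Proof.
move=> mI [Az [w Aw zw]]; apply/seteqP; split=> [_ [y Iy <-]|y Iy].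
  exact: submodM mI Az Iy.
by exists (w * y); [exact: submodM mI Aw Iy | rewrite mulrA zw mul1r].
Qed.

Lemma scale_units (A : set K) z : is_order A -> scale z A = A -> units A z.
Proof.
move=> oA zA; have A1 := order1 oA; split.
  by rewrite -zA; exists 1; rewrite ?mulr1.
have : scale z A 1 by rewrite zA.
by move=> [w Aw zw]; exists w.
Qed.

Lemma units_unit (A : set K) z : units A z -> z \is a GRing.unit.
Proof. by move=> [_ [w _ zw]]; apply/unitrP; exists w; rewrite mulrC. Qed.

(** One set [W] of ideals is counted twice. Over [Cl T] its fibres are the products of one ideal
    with the members of [unit_spans]; over [Cl S] they are orbits of T^x / S^x under scaling. *)
Theorem class_number_ratio : finite_set (Cl T) ->
  [/\ finite_set (Cl S), finite_set (unit_cosets T S) &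
      (ncard (Cl S) * ncard (unit_cosets T S) = ncard unit_spans * ncard (Cl T))%N].
Proof.
move=> fClT.
have clI (A : set K) I : is_order A -> invertible_ideals A I -> Cl A (cl I).
  by move=> oA iI; rewrite ClE //; exists I.
(* Fixing one ideal in every class of [T] is what makes [W] finite; [T] is a dummy value outside
   [Cl T]. *)
have [rep repP] : {r : set (set K) -> set K & forall C,
    Cl T C -> invertible_ideals T (r C) /\ C = cl (r C)}.
  apply: (@choice _ _ (fun C J => Cl T C -> invertible_ideals T J /\ C = cl J)) => C.
  have [CT|nCT] := pselect (Cl T C); last by exists T => /nCT.
  by move: (CT); rewrite ClE // => -[J iJ <-]; exists J.
pose W : set (set K) := [set I | invertible_ideals S I /\
  exists2 C, Cl T C & idmul I T = rep C].
have lift J : invertible_ideals T J ->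
    exists2 I, invertible_ideals S I & idmul I T = J.
  move=> [[lJ mJ] [J' [lJ' mJ'] JJ']].
  have [x [x' [Jx J'x' Lxx']]] := invertible_locally_principal oT PQ mJ mJ' JJ'.
  have [iI IT] := lift_invertible (conj lJ mJ) (conj lJ' mJ') JJ' Jx J'x' Lxx'.
  by exists (spanmod S (idmul L J) x).
have WClT : [set cl (idmul I T) | I in W] = Cl T.
  apply/seteqP; split=> [_ [I [iI _] <-]|C CT].
    by apply: clI => //; exact: invertible_extend.
  have [irC CE] := repP C CT; have [I iI IT] := lift _ irC.
  by exists I; [split=> //; exists C | rewrite IT -CE].
have repE I C : Cl T C -> idmul I T = rep C -> cl (idmul I T) = C.
  by move=> CT ->; have [_ <-] := repP C CT.
have [|||fW cW] := @ncard_fibers _ _ _ (fun I => cl (idmul I T)) W unit_spans.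
- by rewrite WClT.
- exact: finite_unit_spans.
- rewrite WClT => C CT; have [irC CE] := repP C CT; have [I0 iI0 I0T] := lift _ irC.
  have mUS A : unit_spans A -> is_submodule S A.
    by move=> /unit_span_kernel [[[]]].
  exists (idmul I0).
    move=> A B /set_mem UA /set_mem UB E.
    by apply: (idmul_cancel iI0 _ _ E); exact: mUS.
  apply/seteqP; split=> [_ [A /unit_span_kernel [iA AT] <-]|I].
    have E : idmul (idmul I0 A) T = rep C by rewrite -idmulA AT.
    split; last exact: repE.
    by split; [exact: invertible_mul | exists C].
  move=> [[iI [C' CT' IT']] /= clC].
  have IT : idmul I T = rep C.
    by rewrite IT'; congr rep; rewrite -clC; symmetry; exact: repE.
  have [fI0 [J fJ I0J]] := iI0.
  exists (idmul J I); last first.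
    by rewrite idmulA I0J idmul1 //; [exact: order1 | case: iI => [[]]].
  apply/unit_span_kernel; split.
    apply: invertible_mul => //; split=> //; exists I0 => //; by rewrite idmulC.
  by rewrite -idmulA IT -I0T idmulA (idmulC J) I0J.
have WClS : [set cl I | I in W] = Cl S.
  apply/seteqP; split=> [_ [I [iI _] <-]|]; first exact: clI.
  rewrite ClE // => _ [I iI <-].
  have iIT := invertible_extend iI; have CT := clI T _ oT iIT.
  have [irC CE] := repP _ CT.
  have [x ux rE] : exists2 x, x \is a GRing.unit & rep (cl (idmul I T)) = scale x (idmul I T).
    by apply/ideal_class_eq; rewrite -/(cl _) -CE.
  exists (scale x I); last by apply/ideal_class_eq; exists x.
  split; first exact: invertible_scale.
  by exists (cl (idmul I T)) => //; rewrite idmul_scale rE.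
have unitSI (I : set K) z : is_submodule S I ->
    [set x * y | x in [set z * u | u in units S] & y in I] = scale z I.
  move=> mI; apply/seteqP; split=> [_ [_ [u [Su _] <-] [y Iy <-]]|_ [y Iy <-]].
    by exists (u * y); rewrite ?mulrA //; exact: submodM mI Su Iy.
  exists z; last by exists y.
  exists 1; rewrite ?mulr1 //; split; first exact: order1.
  by exists 1; rewrite ?mulr1 //; exact: order1.
(* The extension [z rep C0] of [z I0] equals [rep C0] exactly for [z] in T^x, and [z I0 = t I0]
   means that [z] and [t] differ by an element of S^x, because [I0] can be cancelled. *)
have fib I0 : W I0 -> exists2 g : set K -> set K, {in unit_cosets T S &, injective g} &
    g @` unit_cosets T S = W `&` (cl @^-1` [set cl I0]).
  move=> [iI0 [C0 CT0 I0T]]; have mI0 : is_submodule S I0 by case: iI0 => [[]].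
  have [irC0 CE0] := repP _ CT0.
  exists (fun c => [set x * y | x in c & y in I0]).
    move=> _ _ /set_mem [z Tz <-] /set_mem [t Tt <-]; rewrite !unitSI // => E.
    have ut := units_unit Tt; have uz := units_unit Tz.
    have E2 : scale z S = scale t S.
      apply: (idmul_cancel iI0); [exact: scale_submod | exact: scale_submod |].
      by rewrite !idmul_principal //; exact: order1.
    have [St [w Sw tw]] : units S (t^-1 * z).
      by apply: scale_units => //; rewrite -scaleM E2 scaleK.
    apply/seteqP; split=> [_ [u [Su [v Sv uv]] <-]|_ [u [Su [v Sv uv]] <-]].
      exists (t^-1 * z * u); last by rewrite !mulrA divrr // mul1r.
      split; first exact: orderM.
      exists (w * v); first exact: orderM.
      by rewrite mulrACA tw uv mulr1.
    have tw' : w = z^-1 * t.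
      apply: (mulrI uz); rewrite mulrA divrr // mul1r -[RHS]mulr1 -tw.
      by rewrite !mulrA divrr // mul1r.
    exists (w * u); last by rewrite tw' !mulrA divrr // mul1r.
    split; first exact: orderM.
    exists (t^-1 * z * v); first exact: orderM.
    by rewrite mulrACA (mulrC w) tw uv mulr1.
  apply/seteqP; split=> [_ [_ [z Tz <-] <-]|I].
    have uz := units_unit Tz; rewrite unitSI //; split; last first.
      by rewrite /=; apply/ideal_class_eq; exists z.
    split; first exact: invertible_scale.
    exists C0 => //; rewrite idmul_scale I0T (units_scale _ Tz) //.
    by case: irC0 => [[]].
  move=> [[iI [C CT IT]] /ideal_class_eq [x ux IE]].
  have CC0 : C = C0.
    rewrite -(repE _ _ CT IT) -(repE _ _ CT0 I0T) IE idmul_scale.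
    by apply/ideal_class_eq; exists x.
  have xT : units T x.
    apply: scale_units => //; have [[_ mr] [J [_ mJ] rJ]] := irC0.
    by rewrite -{1}rJ -idmul_scale -I0T -idmul_scale -IE IT CC0 rJ.
  exists [set x * u | u in units S]; first by exists x.
  by rewrite unitSI.
(* A single orbit already embeds T^x / S^x into the finite set [W]. *)
have [I0 WI0] : exists I, W I.
  have iT : invertible_ideals T T.
    by split; [exact: order_fractional | exists T; [exact: order_fractional | exact: idmul_order]].
  have : Cl T (cl T) by exact: clI.
  by rewrite -WClT => -[I WI _]; exists I.
have fU : finite_set (unit_cosets T S).
  have [g ginj gE] := fib I0 WI0.
  suff : finite_set (g @` unit_cosets T S) by rewrite (eq_finite_set (inj_card_eq ginj)).
  by rewrite gE; exact: finite_setIl.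
have fClS : finite_set (Cl S) by rewrite -WClS; exact: finite_image.
split=> //.
have [||_ cW'] := @ncard_fibers _ _ _ cl W (unit_cosets T S) _ fU.
- by rewrite WClS.
- by move=> _ [I WI <-]; exact: fib.
by rewrite mulnC -WClS -cW' cW WClT.
Qed.

End ClassNumberRatio.

(** * Quadratic extensions of a residue field *)

Section QuadraticExtension.
Context {K : comUnitRingType} (S T L : set K) (theta : K).
Hypotheses (oS : is_order S) (oT : is_order T).
Hypotheses (ST : S `<=` T) (lL : is_lattice L) (LS : is_maximal_ideal S L).
Hypotheses (LT : is_submodule T L) (Tth : T theta) (Sth : ~ S theta).
Hypothesis Tgen : forall x, T x ->
  exists s t, [/\ S s, S t & L (x - (s + t * theta))].

Let zS : zmod_closed [in S] := order_zmod oS.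
Let zT : zmod_closed [in T] := order_zmod oT.
Let zL : zmod_closed [in L] := lattice_zmod lL.
Let LsubS : L `<=` S := max_sub LS.
Let L1 : ~ L 1 := max_not1 LS.
Let S1 : S 1 := order1 oS.
Let mLS : is_submodule S L := submod_sub ST LT.

Let LM t x : T t -> L x -> L (t * x). Proof. exact: submodM. Qed.
Let SM x y : S x -> S y -> S (x * y). Proof. exact: orderM. Qed.
Let TM x y : T x -> T y -> T (x * y). Proof. exact: orderM. Qed.

(** Linear independence of 1 and [theta] over the field [S/L]: a [t] invertible modulo [L] would put
    [theta] in [S]. *)
Lemma theta_coef t : S t -> S (t * theta) -> L t.
Proof.
move=> St Stt; apply: contrapT => nLt; have [r Sr Lr] := max_inv oS LS St nLt.
apply: Sth; rewrite (_ : theta = theta * (1 - t * r) + r * (t * theta)); last by ring.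
by apply: zmodD => //; [exact/LsubS/LM | exact: SM].
Qed.

Lemma normalize x : T x -> ~ S x ->
  exists t r a, [/\ S t, S r, S a, L (1 - t * r) & L (x - t * (a + theta))].
Proof.
move=> Tx nSx; have [s [t [Ss St Lx]]] := Tgen Tx.
have nLt : ~ L t.
  move=> Lt; apply: nSx; rewrite -(subrK (s + t * theta) x).
  apply: zmodD (LsubS _) _ => //; apply: zmodD => //.
  by rewrite mulrC; apply/LsubS/LM.
have [r Sr Lr] := max_inv oS LS St nLt.
exists t, r, (s * r); split=> //; first exact: SM.
rewrite (_ : _ - _ = x - (s + t * theta) + s * (1 - t * r)); last by ring.
by apply: zmodD => //; apply: LM => //; exact: ST.
Qed.

(** Equivalently, [- a] is a root modulo [L] of the quadratic polynomial of [theta] over [S/L]. That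
    polynomial is never written down. *)
Definition nonunit a : Prop := S a /\ ~ unit_mod T L (a + theta).
Let line a : set K := spanmod S L (a + theta).

Let lineL a : L `<=` line a. Proof. exact: sub_spanmod. Qed.
Let line_gen a : line a (a + theta). Proof. exact: mem_spanmod. Qed.
Let zline a : zmod_closed [in line a].
Proof. by apply: submod_zmod; exact: spanmod_submod. Qed.

Lemma residue_unit x (I : set K) : is_submodule T I -> L `<=` I -> S x -> ~ L x ->
  I x -> I 1.
Proof.
move=> mI LI Sx nLx Ix; have [y Sy Ly] := max_inv oS LS Sx nLx.
rewrite (_ : 1 = 1 - x * y + y * x); last by ring.
apply: zmodD; [exact: submod_zmod mI | exact: LI | apply: submodM mI _ Ix; exact: ST].
Qed.

(** If some [s * (a + theta)] were congruent to a unit of [S/L], then [a + theta] would itself be a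
    unit. *)
Lemma nonunit_line a x : nonunit a -> S x -> line a x -> L x.
Proof.
move=> [Sa nu] Sx [s Ss Ls]; apply: contrapT => nLx; apply: nu.
split; first by apply: zmodD => //; exact: ST.
have [y Sy Ly] := max_inv oS LS Sx nLx; exists (s * y); first by apply/ST/SM.
rewrite (_ : 1 - _ = (1 - x * y) + y * (x - s * (a + theta))); last by ring.
by apply: zmodD => //; apply: LM => //; exact: ST.
Qed.

Lemma line_reduce a x : S a -> T x -> exists2 s, S s &
  exists2 t, S t & L (x - (s + t * (a + theta))).
Proof.
move=> Sa Tx; have [s [t [Ss St Lx]]] := Tgen Tx.
exists (s - t * a); first by apply: zmodB => //; exact: SM.
by exists t; rewrite // (_ : x - _ = x - (s + t * theta)) //; ring.
Qed.

(** In the plane [T/L], the ideal generated by [a + theta] is proper and contains the line, so it is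
    the line. A larger ideal meets [S] outside [L], hence contains 1. *)
Lemma nonunit_max a : nonunit a -> is_maximal_ideal T (line a).
Proof.
move=> nu; have [Sa nua] := nu; have Ta : T (a + theta) by apply: zmodD => //; exact: ST.
have mJ : is_submodule T (spanmod T L (a + theta)) by exact: spanmod_submod.
have J1 : ~ spanmod T L (a + theta) 1.
  by move=> [t Tt Lt]; apply: nua; split=> //; exists t => //; rewrite mulrC.
have lineJ : line a = spanmod T L (a + theta).
  apply/seteqP; split=> [x [s Ss Ls]|x Jx]; first by exists s => //; exact: ST.
  have Tx : T x.
    by move: Jx; apply: spanmod_sub => // y /LsubS/ST.
  have [s Ss [t St Lx]] := line_reduce Sa Tx; exists t => //.
  suff Ls : L s.
    rewrite (_ : x - _ = x - (s + t * (a + theta)) + s); last by ring.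
    exact: zmodD.
  apply: contrapT => nLs; apply/J1/(residue_unit mJ _ Ss nLs) => //.
    exact: sub_spanmod.
  rewrite (_ : s = x - t * (a + theta) - (x - (s + t * (a + theta)))); last by ring.
  have zJ := submod_zmod mJ; apply: zmodB => //; last exact: sub_spanmod.
  apply: zmodB => //; apply: (submodM mJ); first exact: ST.
  by apply: mem_spanmod => //; exact: order1.
have ideal : is_ideal T (line a).
  by rewrite lineJ; split=> //; apply: spanmod_sub => // y /LsubS/ST.
split=> //; first by move=> E; apply: J1; rewrite -lineJ E; exact: order1.
move=> I iI lineI; have [Ilin|nI] := pselect (I `<=` line a).
  by left; apply/seteqP.
right; have [x Ix nx] : exists2 x, I x & ~ line a x.
  by apply: contrapT => H; apply: nI => x Ix; apply: contrapT => nx; apply: H; exists x.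
have Tx : T x by case: iI => _; apply.
have mI := ideal_submod iI; have zI := ideal_zmod iI.
have [s Ss [t St Lx]] := line_reduce Sa Tx.
apply: ideal_eq1 => //; apply: (residue_unit mI _ Ss) => //.
- by move=> y Ly; apply: lineI; exact: lineL.
- move=> Ls; apply: nx; exists t => //.
  rewrite (_ : x - _ = x - (s + t * (a + theta)) + s); last by ring.
  exact: zmodD.
rewrite (_ : s = x - t * (a + theta) - (x - (s + t * (a + theta)))); last by ring.
apply: zmodB => //; last by apply: lineI; exact: lineL.
apply: zmodB => //; apply: (submodM mI); first exact: ST.
by apply: lineI; exact: line_gen.
Qed.

Lemma line_inj a b : nonunit a -> S b -> line a (b + theta) -> L (a - b).
Proof.
move=> nua Sb lab; apply: (nonunit_line nua); first by apply: zmodB => //; case: nua.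
rewrite (_ : a - b = a + theta - (b + theta)); last by ring.
by apply: zmodB.
Qed.

Lemma nonunit_mem x : T x -> ~ unit_mod T L x ->
  L x \/ exists2 a, nonunit a & line a x.
Proof.
move=> Tx nux; have [Lx|nLx] := pselect (L x); [by left | right].
have [Sx|nSx] := pselect (S x).
  case: nux; split=> //; have [y Sy Ly] := max_inv oS LS Sx nLx.
  by exists y => //; exact: ST.
have [t [r [a [St Sr Sa Ltr Lx]]]] := normalize Tx nSx.
exists a; last by exists t.
split=> // -[_ [y Ty Ly]]; apply: nux; split=> //; exists (r * y).
  by apply: TM => //; exact: ST.
rewrite (_ : 1 - _ = 1 - (a + theta) * y + (a + theta) * y * (1 - t * r)
   - r * y * (x - t * (a + theta))); last by ring.
have Ta : T (a + theta) by apply: zmodD => //; exact: ST.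
apply: zmodB => //; last by apply: LM => //; apply: TM => //; exact: ST.
by apply: zmodD => //; apply: LM => //; exact: TM.
Qed.

(** Being comaximal, the two lines have their intersection as product. A common element, congruent
    to [s * (a + theta)], yields [s * (a - b)] in [L], hence [s] in [L]. *)
Lemma two_nonunits a b : nonunit a -> nonunit b -> ~ L (a - b) ->
  line a <> line b /\ idmul (line a) (line b) = L.
Proof.
move=> nua nub nLab; have ma := nonunit_max nua; have mb := nonunit_max nub.
have ne : line a <> line b.
  move=> E; apply: nLab; apply: (line_inj nua); first by case: nub.
  by rewrite E; exact: line_gen.
split=> //; apply/seteqP; split.
  apply: idmul_sub => // x y ax By.
  have Tx := max_sub ma ax; have Ty := max_sub mb By.
  have : line a (x * y) by rewrite mulrC; exact: max_mul ma Ty ax.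
  have : line b (x * y) by exact: max_mul mb Tx By.
  move: (x * y) => {x y ax By Tx Ty} z bz [s Ss Lz].
  rewrite -(subrK (s * (a + theta)) z); apply: zmodD => //.
  rewrite mulrC; apply: LM; first by apply: zmodD => //; apply: ST; case: nua.
  have Sab : S (a - b) by apply: zmodB => //; [case: nua | case: nub].
  have : L (s * (a - b)).
    apply: (nonunit_line nub); first exact: SM.
    rewrite (_ : s * _ = z - s * (b + theta) - (z - s * (a + theta))); last by ring.
    apply: zmodB => //; last exact: lineL.
    by apply: zmodB => //; apply: max_mul mb _ (line_gen b); exact: ST.
  by case/(max_prime oS LS).
have [e ea eb] : exists2 e, line a e & line b (1 - e).
  apply: (max_comax oT mb (max_ideal ma)) => ab.
  by apply: ne; exact: max_sub_eq ma mb ab.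
move=> x Lx; rewrite (_ : x = e * x + x * (1 - e)); last by ring.
apply: (zmodD (@idmul_zmod _ _ _)); apply: mem_idmul => //; exact: lineL.
Qed.

(** The prime ideal [line c] contains [L], the product of the other two lines, hence contains one of
    them. *)
Lemma third_nonunit a b c : nonunit a -> nonunit b -> ~ L (a - b) -> nonunit c ->
  L (a - c) \/ L (b - c).
Proof.
move=> nua nub nLab nuc; have [_ E] := two_nonunits nua nub nLab.
have mc := nonunit_max nuc; have Sc : S c by case: nuc.
have [ac|nac] := pselect (line a `<=` line c).
  left; apply: (line_inj nua) => //.
  by rewrite (max_sub_eq (nonunit_max nua) mc ac); exact: line_gen.
right; apply: (line_inj nub) => //.
suff bc : line b `<=` line c.
  by rewrite (max_sub_eq (nonunit_max nub) mc bc); exact: line_gen.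
move=> y By; apply: contrapT => ncy; apply: nac => x ax.
have : line c (x * y) by apply: lineL; rewrite -E; exact: mem_idmul.
have Tx := max_sub (nonunit_max nua) ax; have Ty := max_sub (nonunit_max nub) By.
by case/(max_prime oT mc Tx Ty).
Qed.

(** If the square of [a + theta] is [s * (a + theta)] modulo [L], then [a - s] is a nonunit too, the
    conjugate root, and uniqueness forces [s] into [L]. *)
Lemma unique_nonunit_square a : nonunit a -> (forall b, nonunit b -> L (a - b)) ->
  forall x y, line a x -> line a y -> L (x * y).
Proof.
move=> nua uniq; have ma := nonunit_max nua; have [Sa _] := nua.
have Ta : T (a + theta) by apply: zmodD => //; exact: ST.
have Lu2 : L ((a + theta) * (a + theta)).
  have [s Ss Lu] : line a ((a + theta) * (a + theta)).
    exact: max_mul ma Ta (line_gen a).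
  suff Ls : L s.
    rewrite -(subrK (s * (a + theta)) (_ * _)); apply: zmodD => //.
    by rewrite mulrC; exact: LM.
  have Sas : S (a - s) by exact: zmodB.
  have [[Tu [v Tv Lv]]|nu] := pselect (unit_mod T L (a - s + theta)).
    case: Sth; rewrite (_ : theta = a + theta - a); last by ring.
    apply: zmodB => //; apply: LsubS.
    rewrite (_ : a + theta = (a + theta) * (1 - (a - s + theta) * v)
      + v * ((a + theta) * (a + theta) - s * (a + theta))); last by ring.
    by apply: zmodD => //; exact: LM.
  by rewrite (_ : s = a - (a - s)); [exact: uniq | ring].
move=> x y ax ay; have Ty := max_sub ma ay.
move: ax ay => [s Ss Lx] [t St Ly].
rewrite (_ : x * y = y * (x - s * (a + theta)) + s * (a + theta) * (y - t * (a + theta))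
  + s * t * ((a + theta) * (a + theta))); last by ring.
apply: zmodD => //; last by apply: LM => //; apply/ST/SM.
by apply: zmodD => //; apply: LM => //; apply: TM => //; exact: ST.
Qed.

Lemma line_spanmod a v : nonunit a -> line a v -> ~ L v -> line a `<=` spanmod S L v.
Proof.
move=> [Sa _] [s Ss Lv] nLv x [t St Lx].
have Ta : T (a + theta) by apply: zmodD => //; exact: ST.
have nLs : ~ L s.
  move=> Ls; apply: nLv; rewrite -(subrK (s * (a + theta)) v).
  by apply: zmodD => //; rewrite mulrC; exact: LM.
have [r Sr Lr] := max_inv oS LS Ss nLs; exists (t * r); first exact: SM.
rewrite (_ : _ - _ = x - t * (a + theta) + t * (a + theta) * (1 - s * r)
   - t * r * (v - s * (a + theta))); last by ring.
apply: zmodB => //; last by apply: LM => //; apply/ST/SM.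
by apply: zmodD => //; apply: LM => //; apply: TM => //; exact: ST.
Qed.

Let coset a : set K := [set a + b | b in L].

(** The total [q + 1] is the number of lines of the plane [T/L] over a field of [q] elements, with
    [S] as the point at infinity. Stating a sum avoids truncated subtraction. *)
Lemma card_unit_spans : exists B : set (set K),
  [/\ forall c, B c <-> exists2 a, nonunit a & c = coset a,
      finite_set (residue_ring S L) &
      (ncard (unit_spans S T L) + ncard B = (ncard (residue_ring S L)).+1)%N].
Proof.
pose B : set (set K) := [set c | exists2 a, nonunit a & c = coset a].
have fR : finite_set (residue_ring S L) by apply: finite_cosets => //; exact: order_lattice.
have BR : B `<=` residue_ring S L by move=> _ [a [Sa _] ->]; exists a.
exists B; split=> //.
have fX : finite_set (unit_spans S T L) by exact: finite_unit_spans.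
(* The line of a residue class, written without choosing a representative, so that it is a function
   of the coset. *)
pose g (c : set K) : set K :=
  [set z | exists2 s, S s & exists2 a, c a & L (z - s * (a + theta))].
have gE a : S a -> g (coset a) = line a.
  move=> Sa; apply/seteqP; split=> [z [s Ss [_ [l Ll <-] Lz]]|z [s Ss Lz]].
    exists s => //.
    rewrite (_ : _ - _ = z - s * (a + l + theta) + s * l); last by ring.
    by apply: zmodD => //; apply: LM => //; exact: ST.
  exists s => //; exists a => //; exists 0; rewrite ?addr0 //; exact: zmod0.
have linenS a : S a -> line a <> S.
  move=> Sa E; apply: Sth; rewrite (_ : theta = a + theta - a); last by ring.
  by apply: zmodB => //; rewrite -[X in X _]E; exact: line_gen.
have spanS u : S u -> ~ L u -> spanmod S L u = S.
  move=> Su nLu; apply/seteqP; split=> [|x Sx].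
    by apply: spanmod_sub => //; exact: order_submod.
  have [r Sr Lr] := max_inv oS LS Su nLu; exists (x * r); first exact: SM.
  by rewrite (_ : _ - _ = x * (1 - u * r)); [apply: LM => //; exact: ST | ring].
have XS : unit_spans S T L S.
  exists 1; last exact: spanS.
  split; first exact: ST.
  by exists 1; rewrite ?mulr1 ?subrr; [exact: ST | exact: zmod0].
have XE : unit_spans S T L `\ S = g @` (residue_ring S L `\` B).
  apply/seteqP; split=> [I [[u [Tu [v Tv Lv]] <-] IS]|_ [c [[a Sa <-] nB] <-]].
    have [Su|nSu] := pselect (S u).
      case: IS; apply: spanS => // Lu; apply: L1.
      by rewrite -(subrK (u * v) 1); apply: zmodD => //; rewrite mulrC; exact: LM.
    have [t [r [a [St Sr Sa Ltr Lu]]]] := normalize Tu nSu.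
    have Ta : T (a + theta) by apply: zmodD => //; exact: ST.
    have unita : unit_mod T L (a + theta).
      split=> //; exists (t * v); first by apply: TM => //; exact: ST.
      rewrite (_ : 1 - _ = (1 - u * v) + v * (u - t * (a + theta))); last by ring.
      by apply: zmodD => //; exact: LM.
    exists (coset a).
      split; first by exists a.
      move=> [b nub Eab]; have Lab : L (a - b) by apply/mem_coset.
      case: nub => Sb; apply; split; first by apply: zmodD => //; exact: ST.
      have [_ [w Tw Lw]] := unita; exists w => //.
      rewrite (_ : 1 - _ = 1 - (a + theta) * w + w * (a - b)); last by ring.
      by apply: zmodD => //; exact: LM.
    rewrite gE //; apply/seteqP; split=> x [s Ss Lx].
      exists (s * r); first exact: SM.
      rewrite (_ : x - _ = x - s * (a + theta) + s * (a + theta) * (1 - t * r)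
        - s * r * (u - t * (a + theta))); last by ring.
      apply: zmodB => //; last by apply: LM => //; apply/ST/SM.
      by apply: zmodD => //; apply: LM => //; apply: TM => //; exact: ST.
    exists (s * t); first exact: SM.
    rewrite (_ : x - _ = x - s * u + s * (u - t * (a + theta))); last by ring.
    by apply: zmodD => //; apply: LM => //; exact: ST.
  rewrite gE //; split; last exact: linenS.
  exists (a + theta) => //; apply: contrapT => nu; apply: nB; exists a => //.
rewrite (ncardD1 fX XS) addSn; congr _.+1.
rewrite XE ncard_image; first last.
- move=> _ _ /set_mem [[a Sa <-] _] /set_mem [[b Sb <-] _].
  rewrite !gE // => E; apply/mem_coset => //.
  have [s Ss Ls] : line b (a + theta) by rewrite -E; exact: line_gen.
  (* Comparison of the coefficients of [theta]. *)
  have L1s : L (1 - s).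
    apply: theta_coef; first exact: zmodB.
    rewrite (_ : _ * _ = a + theta - s * (b + theta) - a + s * b); last by ring.
    apply: zmodD => //; last exact: SM.
    by apply: zmodB => //; exact: LsubS.
  rewrite (_ : a - b = a + theta - s * (b + theta) - (b + theta) * (1 - s)); last by ring.
  by apply: zmodB => //; apply: LM => //; apply: zmodD => //; exact: ST.
- exact: finite_setD.
have fB := sub_finite_set BR fR.
rewrite /ncard fset_setD // cardfsDS ?subnK //.
  by apply: fsubset_leq_card; rewrite -fset_set_sub.
by rewrite -fset_set_sub.
Qed.

Theorem quadratic_trichotomy :
  let q := ncard (residue_ring S L) in let u := ncard (unit_spans S T L) in
  [\/ units_outside T L L L /\ u = q.+1,
      exists P, [/\ units_outside T L P P, L `<=` P, ~ P `<=` L,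
        (forall x y, P x -> P y -> L (x * y)) /\
        (forall v, P v -> ~ L v -> P `<=` spanmod S L v) & u = q] |
      exists P Q, [/\ units_outside T L P Q, P <> Q, L = idmul P Q & u.+1 = q]].
Proof.
have [B [BE fR cX]] := card_unit_spans; have fB : finite_set B.
  apply: sub_finite_set fR => c /BE [a [Sa _] ->]; by exists a.
move=> q u; have [B0|nB0] := pselect (exists a, nonunit a); last first.
  apply: Or31; split; last first.
    have B0 : B = set0.
      by apply/seteqP; split=> // c /BE [a nua _]; apply: nB0; exists a.
    by move: cX; rewrite B0 ncard0 addn0.
  have unitL x : T x -> ~ L x -> unit_mod T L x.
    move=> Tx nLx; apply: contrapT => nu.
    have [//|[a nua _]] := nonunit_mem Tx nu; by apply: nB0; exists a.
  have mL : is_maximal_ideal T L.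
    split; [split=> // y /LsubS/ST // | by move=> E; apply: L1; rewrite E; exact: ST |].
    move=> I iI LI; have [IL|nIL] := pselect (I `<=` L).
      by left; apply/seteqP.
    right; apply: ideal_eq1 => //.
    have [x Ix nLx] : exists2 x, I x & ~ L x.
      by apply: contrapT => H; apply: nIL => x Ix; apply: contrapT => nx; apply: H; exists x.
    have Tx : T x by case: iI => _; apply.
    have [_ [y Ty Ly]] := unitL x Tx nLx.
    rewrite -(subrK (x * y) 1); apply: (zmodD (ideal_zmod iI)); first exact: LI.
    by rewrite mulrC; exact: submodM (ideal_submod iI) Ty Ix.
  by split=> // x Tx nLx _; exact: unitL.
have [a nua] := B0; have ma := nonunit_max nua.
have [[b nub nLab]|uniq] := pselect (exists2 b, nonunit b & ~ L (a - b)).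
  apply: Or33; exists (line a), (line b).
  have [ne E] := two_nonunits nua nub nLab; split=> //.
    split=> //; first exact: nonunit_max.
    move=> x Tx nax nbx; apply: contrapT => nu.
    have [Lx|[c nuc lcx]] := nonunit_mem Tx nu; first by apply: nax; exact: lineL.
    have E2 d : nonunit d -> L (d - c) -> line d = line c.
      move=> nud Ldc; apply: max_sub_eq (nonunit_max nud) (nonunit_max nuc) _.
      apply: spanmod_sub => //; first by apply: submod_sub ST _; case: (nonunit_max nuc) => [[]].
      rewrite (_ : d + theta = d - c + (c + theta)); last by ring.
      by apply: zmodD => //; exact: lineL.
    have [Lac|Lbc] := third_nonunit nua nub nLab nuc.
      by apply: nax; rewrite (E2 a).
    by apply: nbx; rewrite (E2 b).
  have Bab : B = [set coset a; coset b].
    apply/seteqP; split=> [c /BE [d nud ->]|c [->|->]]; last 2 first.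
    - by apply/BE; exists a.
    - by apply/BE; exists b.
    have [Lad|Lbd] := third_nonunit nua nub nLab nud.
      by left; apply/mem_coset => //; rewrite -opprB; exact: zmodN.
    by right; apply/mem_coset => //; rewrite -opprB; exact: zmodN.
  move: cX; rewrite (ncardD1 fB (x := coset a)); last by rewrite Bab; left.
  have -> : B `\ coset a = [set coset b].
    rewrite Bab; apply/seteqP; split=> [c [[->|->] nc]|c ->] //; first by case: nc.
    split; first by right.
    by move=> /mem_coset-/(_ zL) Lba; apply: nLab; rewrite -opprB; exact: zmodN.
  by rewrite /q /u /ncard fset_set1 cardfs1 addn2 => -[].
have uniq' b : nonunit b -> L (a - b).
  by move=> nub; apply: contrapT => H; apply: uniq; exists b.
apply: Or32; exists (line a); split.
- split=> // x Tx nax _; apply: contrapT => nu.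
  have [Lx|[c nuc lcx]] := nonunit_mem Tx nu; first by apply: nax; exact: lineL.
  apply: nax; have Lac := uniq' c nuc.
  rewrite (_ : line a = line c) //; apply: max_sub_eq ma (nonunit_max nuc) _.
  apply: spanmod_sub => //; first by apply: submod_sub ST _; case: (nonunit_max nuc) => [[]].
  rewrite (_ : a + theta = a - c + (c + theta)); last by ring.
  by apply: zmodD => //; exact: lineL.
- exact: lineL.
- move=> laL; apply: Sth; rewrite (_ : theta = a + theta - a); last by ring.
  by apply: zmodB => //; [apply/LsubS/laL; exact: line_gen | case: nua].
- by split; [exact: unique_nonunit_square | move=> v; exact: line_spanmod].
have -> : u = q; last by [].
move: cX; rewrite (_ : B = [set coset a]).
  by rewrite /ncard fset_set1 cardfs1 addn1 => -[].
apply/seteqP; split=> [c /BE [d nud ->]|c ->]; last by apply/BE; exists a.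
by apply/mem_coset => //; rewrite -opprB; apply: zmodN => //; exact: uniq'.
Qed.

End QuadraticExtension.

(** * Associated primes and localization *)

Section ArtinianQuotients.
Context {K : comUnitRingType}.
Implicit Types (S T f I J L M P Q : set K) (x y z : K).

Lemma ideal_between T f I : is_ideal T I -> f `<=` I ->
  [set M : set K | [/\ zmod_closed [in M], f `<=` M & M `<=` T]] I.
Proof. by move=> [[zI _] IT] fI. Qed.

Lemma exists_max T J : is_order T -> is_lattice J -> is_ideal T J -> J <> T ->
  exists2 P, is_maximal_ideal T P & J `<=` P.
Proof.
move=> oT lJ iJ JT; pose X : set (set K) := [set I | [/\ is_ideal T I, J `<=` I & I <> T]].
have fX : finite_set X.
  apply: sub_finite_set (finite_between lJ (order_lattice oT)).
  by move=> I [iI JI _]; exact: ideal_between.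
have [P [[iP JP PT] _ Pmax]] := finite_maximal fX (And3 iJ (@subset_refl _ J) JT).
exists P => //; split=> // I iI PI; have [->|IT] := pselect (I = T); [by right | left].
by apply: Pmax => //; split=> //; exact: subset_trans JP PI.
Qed.

(** [T/f] is finite, so two powers of [z] agree modulo [f]. *)
Lemma powers_coset T f z : is_order T -> is_lattice f -> T z ->
  exists a b : nat, (0 < b)%N /\ f (z ^+ a - z ^+ (a + b)).
Proof.
move=> oT lf Tz; have zf := lattice_zmod lf; apply: contrapT => H.
pose c (n : nat) := [set z ^+ n + y | y in f].
suff : {in [set: nat] &, injective c}.
  move=> cinj; apply: infinite_nat.
  rewrite -(eq_finite_set (inj_card_eq cinj)).
  apply: sub_finite_set (finite_cosets lf (order_lattice oT)).
  by move=> _ [n _ <-]; exists (z ^+ n) => //; exact: orderX.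
move=> m n _ _ E; apply: contrapT => mn; apply: H.
wlog lt : m n E mn / (m < n)%N.
  move=> W; have [lt|lt|//] := ltngtP m n; first exact: W E mn lt.
  by apply: (W n m) => // e; apply: mn.
exists m, (n - m)%N; rewrite subn_gt0 subnKC ?(ltnW lt) //; split=> //.
exact/mem_coset.
Qed.

(* P is the annihilator of an element of T/f: among the annihilators of elements
   that are contained in P, a maximal one is P itself. *)
Lemma associated_prime T f P : is_order T -> is_lattice f -> is_submodule T f ->
  is_maximal_ideal T P -> f `<=` P ->
  exists y, [/\ T y, ~ f y & forall p, P p -> f (p * y)].
Proof.
move=> oT lf mf mP fP; have zf := lattice_zmod lf; have zT := order_zmod oT.
pose ann y : set K := [set s | T s /\ f (s * y)].
have P1 := max_not1 mP; have fM x y : T x -> f y -> f (x * y) by exact: submodM.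
have TM x y : T x -> T y -> T (x * y) by exact: orderM.
pose X : set (set K) := [set A | exists2 y, T y & A = ann y /\ A `<=` P].
have fT : f `<=` T by move=> x /fP; exact: max_sub mP x.
have fX : finite_set X.
  apply: sub_finite_set (finite_between lf (order_lattice oT)).
  move=> _ [y Ty [-> _]]; split.
  - apply/zmodP; split; first by split; [exact: zmod0 | rewrite mul0r; exact: zmod0].
    move=> s t [Ts fs] [Tt ft]; split; first exact: zmodB.
    by rewrite mulrBl; exact: zmodB.
  - by move=> s fs; split; [exact: fT | rewrite mulrC; exact: fM].
  - by move=> s [].
have X1 : X (ann 1).
  exists 1; first exact: order1.
  by split=> // s [_]; rewrite mulr1; exact: fP.
have [_ [[y Ty [-> yP]] _ ymax]] := finite_maximal fX X1.
have same z : T z -> ann y `<=` ann z -> ann z `<=` P -> ann z `<=` ann y.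
  by move=> Tz yz zP; rewrite (ymax (ann z)) //; exists z.
exists y; split=> //.
  by move=> fy; apply: P1; apply: yP; split; [exact: order1 | rewrite mul1r].
move=> z Pz; have Tz : T z by exact: max_sub mP z Pz.
have up w : T w -> ann y `<=` ann (w * y).
  by move=> Tw s [Ts fs]; split=> //; rewrite mulrCA; exact: fM.
(* If [s] outside [P] kills [z * y], then [ann (s * y)] is still inside [P], so it equals [ann y],
   and it contains [z]. *)
have [zP|nzP] := pselect (ann (z * y) `<=` P); last first.
  have [s [Ts fs] Ps] : exists2 s, ann (z * y) s & ~ P s.
    by apply: contrapT => H; apply: nzP => s As; apply: contrapT => Ps; apply: H; exists s.
  have [] // : ann y z.
  apply: (same (s * y)); first exact: TM; first exact: up.
    move=> t [Tt ft]; have [] // : P t \/ P s; apply: (max_prime oT mP) => //.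
    by apply: yP; split; [exact: TM | rewrite -mulrA].
  by split=> //; rewrite mulrCA.
have annX n : ann (z ^+ n * y) `<=` ann y.
  elim: n => [|n IH s [Ts fs]]; first by rewrite expr0 mul1r.
  apply: IH; split=> //.
  have [_] : ann y (s * z ^+ n); last by rewrite mulrA.
  apply: (same (z * y)) => //; first exact: TM; first exact: up.
  split; first by apply: TM => //; exact: orderX.
  by rewrite mulrA -(mulrA s) -exprSr -mulrA.
(* By [annX] the factor [z ^+ a] can be cancelled: [1 - z ^+ b] kills [y], hence lies in [P]
   together with [z ^+ b]. *)
have [a [b [b0 fab]]] := powers_coset oT lf Tz.
case: P1; have Tzb : T (z ^+ b) by exact: orderX.
have Pzb : P (z ^+ b).
  by rewrite -(prednK b0) exprSr; apply: max_mul mP _ Pz; exact: orderX.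
rewrite -(subrK (z ^+ b) 1); apply: (zmodD (max_zmod mP)) => //.
apply/yP/(annX a); split; first by apply: zmodB => //; exact: order1.
rewrite (_ : _ * _ = y * (z ^+ a - z ^+ (a + b))); last by rewrite exprD; ring.
exact: fM.
Qed.

(** An element [y] outside [l] has an inverse [z] modulo [l]; some power of [1 - y * z] lies in [Q],
    so [y] is invertible modulo [Q] as well. *)
Lemma max_primary S l Q : is_order S -> is_maximal_ideal S l -> is_ideal S Q ->
  Q `<=` l -> (forall y, l y -> exists n, Q (y ^+ n)) -> is_primary_for S l Q.
Proof.
move=> oS ml iQ Ql lQ; have zl := max_zmod ml; have l1 := max_not1 ml.
have powl x n : S x -> l (x ^+ n) -> l x.
  move=> Sx; elim: n => [|n IH]; first by rewrite expr0 => /l1.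
  by rewrite exprS => /(max_prime oS ml Sx (orderX n oS Sx)) [].
split=> //.
- by move=> E; apply/l1/Ql; rewrite E; exact: order1.
- move=> x y Sx Sy Qxy; have [ly|nly] := pselect (l y); [by right; exact: lQ | left].
  have [z Sz lz] := max_inv oS ml Sy nly; have [n Qn] := lQ _ lz.
  have [w Sw wE] : exists2 w, S w & 1 - (1 - y * z) ^+ n = y * w.
    elim: n {Qn} => [|n [w Sw wE]]; first by exists 0; [exact: zmod0 (order_zmod oS) | rewrite subrr mulr0].
    exists (w + z * (1 - y * z) ^+ n).
      apply: zmodD => //; first exact: order_zmod.
      by apply: orderM => //; apply: orderX => //; exact: max_sub ml _ lz.
    by rewrite exprS mulrDr -wE; ring.
  have mQ := ideal_submod iQ.
  rewrite (_ : x = x * (1 - y * z) ^+ n + w * (x * y)); last first.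
    have -> : w * (x * y) = x * (y * w) by ring.
    by rewrite -wE; ring.
  by apply: (zmodD (ideal_zmod iQ)); [exact: submodM mQ Sx Qn | exact: submodM mQ Sw Qxy].
apply/seteqP; split=> [x [Sx [n /Ql]]|x lx]; first exact: powl.
by split; [exact: max_sub ml x lx | exact: lQ].
Qed.

Lemma max_contraction S0 l0 T P : is_order S0 -> is_maximal_ideal S0 l0 ->
  is_maximal_ideal T P -> S0 `<=` T -> l0 `<=` P -> P `&` S0 = l0.
Proof.
move=> oS0 ml0 mP S0T l0P; have [_ _ l0max] := ml0.
have zS0 := order_zmod oS0; have zP := max_zmod mP.
have iPS : is_ideal S0 (P `&` S0).
  split; last by move=> x [].
  split; first by exact: zmod_setI.
  move=> a x Sa [Px Sx]; split; last exact: orderM.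
  by apply: max_mul mP _ Px; exact: S0T.
have l0PS : l0 `<=` P `&` S0.
  by move=> x lx; split; [exact: l0P | exact: max_sub ml0 x lx].
have [//|E] := l0max _ iPS l0PS.
have [] : (P `&` S0) 1 by rewrite E; exact: order1.
by move/(max_not1 mP).
Qed.

End ArtinianQuotients.

(** * Extension of [l] to an order with the same localization *)

Section Localization.
Context {K : comUnitRingType} (R l S : set K).
Hypotheses (oR : is_order R) (oS : is_order S) (RS : R `<=` S).
Hypotheses (ml : is_maximal_ideal R l) (RlS : localization R l S = localization R l R).

(** Equality of [x / 1] with a fraction [r / s] of [R] means [u * s * x = u * r] for some [u]
    outside [l]; the denominator is [u * s], as [u] may be a zero divisor and cannot be
    cancelled. *)
Lemma localization_denominator x : S x -> exists t, [/\ R t, ~ l t & R (t * x)].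
Proof.
move=> Sx; have R1 := order1 oR; have l1 := max_not1 ml.
have : localization R l S (locfrac R l x 1) by exists x => //; exists 1.
rewrite RlS => -[r Rr [s [Rs ls] E]].
have : locfrac R l x 1 (x, 1).
  by split=> //; exists 1 => //; rewrite subrr mulr0.
rewrite -E => -[_ /= [u [Ru lu]]]; rewrite mul1r mulrBr => /eqP.
rewrite subr_eq0 => /eqP ur; exists (u * s); split.
- exact: orderM.
- by case/(max_prime oR ml).
by rewrite -mulrA -ur; exact: orderM.
Qed.

Lemma common_denominator : exists t, [/\ R t, ~ l t & forall x, S x -> R (t * x)].
Proof.
have [[s Ss] _] := order_lattice oS.
have [t [Rt lt Hs]] : exists t, [/\ R t, ~ l t & forall x, x \in s -> R (t * x)].
  have sS x : x \in s -> S x by move=> xs; rewrite Ss; apply: sub_zspan.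
  elim: s {Ss} sS => [|y s IH] sS.
    by exists 1; split=> //; [exact: order1 | exact: max_not1 ml].
  have [|t [Rt lt Ht]] := IH; first by move=> x xs; apply: sS; rewrite inE xs orbT.
  have [|u [Ru lu Ruy]] := @localization_denominator y; first by apply: sS; rewrite inE eqxx.
  exists (t * u); split; first exact: orderM.
    by case/(max_prime oR ml).
  move=> x; rewrite inE => /orP [/eqP ->|/Ht Htx].
    by rewrite -mulrA; exact: orderM.
  by rewrite mulrAC; exact: orderM.
exists t; split=> // x; rewrite Ss; move: x; apply: zspan_sub => //.
by apply: zmod_preimage; exact: order_zmod.
Qed.

Let lS := idmul l S.

Lemma sub_extension : l `<=` lS.
Proof. by move=> x lx; rewrite -[x]mulr1; apply: mem_idmul => //; exact: order1. Qed.

(** A common denominator [t] carries [l S] into [l], and [t] cancels modulo the prime [l]. *)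
Lemma extension_contraction : lS `&` R = l.
Proof.
have [t [Rt lt tS]] := common_denominator.
apply/seteqP; split=> [x [lSx Rx]|x lx]; last first.
  by split; [exact: sub_extension | exact: max_sub ml x lx].
have : l (t * x).
  move: x lSx {Rx}; apply: idmul_sub.
    by apply: zmod_preimage; exact: max_zmod ml.
  move=> x y lx Sy /=; rewrite mulrCA mulrC; apply: max_mul ml _ lx; exact: tS.
by case/(max_prime oR ml).
Qed.

Lemma extension_residue x : S x -> exists2 r, R r & lS (x - r).
Proof.
move=> Sx; have [t [Rt lt Rtx]] := localization_denominator Sx.
have [u Ru lu] := max_inv oR ml Rt lt; exists (u * (t * x)); first exact: orderM.
rewrite (_ : _ - _ = (1 - t * u) * x); last by ring.
exact: mem_idmul.
Qed.

(** As [S = R + l S], an ideal of [S] containing [l S] is determined by its trace on [R]. *)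
Lemma extension_max : is_maximal_ideal S lS.
Proof.
have mlS : is_submodule S lS.
  by rewrite /lS idmulC; apply: idmul_submod; exact: order_submod.
have ilS : is_ideal S lS.
  split=> //; apply: idmul_sub; first exact: order_zmod.
  by move=> x y /(max_sub ml)/RS; exact: orderM.
have l1 := max_not1 ml; have [_ _ lmax] := ml.
split=> // [E|I iI lSI].
  apply: l1; have [] : (lS `&` R = l) by exact: extension_contraction.
  by move=> <-; split; [rewrite E; exact: order1 | exact: order1].
have zI := ideal_zmod iI; have mI := ideal_submod iI.
have iIR : is_ideal R (I `&` R).
  split; last by move=> x [].
  split; first by apply: zmod_setI => //; exact: order_zmod.
  move=> a x Ra [Ix Rx]; split; last exact: orderM.
  by apply: (submodM mI) => //; exact: RS.
have lIR : l `<=` I `&` R.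
  by move=> x lx; split; [apply: lSI; exact: sub_extension | exact: max_sub ml x lx].
have [E|E] := lmax _ iIR lIR; [left|right]; last first.
  apply: ideal_eq1 => //.
  by have [] : (I `&` R) 1 by rewrite E; exact: order1.
apply/seteqP; split=> // x Ix; have Sx : S x by case: iI => _; apply.
have [r Rr lSr] := extension_residue Sx.
rewrite -(subrK r x); apply: (zmodD (@idmul_zmod _ _ _)) => //; apply: sub_extension.
rewrite -E; split=> //; rewrite -(subKr x r); apply: zmodB => //; exact: lSI.
Qed.

End Localization.

(** * Conductors and singular primes *)

Section Singular.
Context {K : comUnitRingType}.
Hypothesis pK : is_product_of_number_fields K.
Implicit Types (R S T l L M P Q : set K) (x y z : K).

Let uK : natunits K := number_fields_natunits pK.

Lemma conductor_submod S : is_order S -> is_submodule S (conductor S).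
Proof. by move=> oS; apply: colon_submod; exact: order_submod. Qed.

Lemma max_order1 : (max_order : set K) 1.
Proof.
exists ('X - 1); first exact: monicXsubC.
by rewrite rmorphB rmorph1 /= map_polyX root_XsubC.
Qed.

Lemma conductor_sub S : conductor S `<=` S.
Proof. by move=> x /(_ 1 max_order1); rewrite mulr1. Qed.

(** [max_order] lies in an order [M], and a positive integer carries [M] into [S]. *)
Lemma conductor_lattice S : is_order S -> is_lattice (conductor S).
Proof.
move=> oS; have mc := conductor_submod oS.
apply: sub_lattice (order_lattice oS) (submod_zmod mc) _ _; first exact: conductor_sub.
move=> x; have [M [oM SM maxM]] := max_order_bounded pK oS.
have [m m0 Hm] := lattice_absorb (order_lattice oM) (order_zmod oS)
  (fun x => lattice_full x (order_lattice oS)).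
have [k k0 Sk] := lattice_full x (order_lattice oS).
exists (k * m)%N; first by rewrite muln_gt0 k0.
move=> y /maxM My; rewrite mulrnA mulrnAl -mulrnAr; apply: orderM => //.
exact: Hm.
Qed.

Lemma singular_lattice R l : is_order R -> is_singular R l -> is_lattice l.
Proof.
move=> oR [ml cl]; have := conductor_lattice oR => lc.
by apply: sup_lattice lc (order_lattice oR) (max_zmod ml) cl _; exact: max_sub ml.
Qed.

(** The ideal [(S : (l : l))] contains [l], so by maximality it is [l] or [S], matching the two
    cases of the definition. *)
Lemma self_colon_loverorder S l : is_order S -> is_lattice l ->
  is_maximal_ideal S l -> is_loverorder S l (colon l l).
Proof.
move=> oS ll ml; have oC := colon_order uK ll.
have SC : S `<=` colon l l by move=> x Sx y ly; exact: max_mul ml Sx ly.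
split=> //; set Q := colon S (colon l l).
have QS : Q `<=` S by move=> x /(_ 1 (@colon_self1 _ l)); rewrite mulr1.
have iQ : is_ideal S Q by split=> //; apply: colon_submod; exact: order_submod.
have lQ : l `<=` Q by move=> x lx y Cy; rewrite mulrC; apply: (max_sub ml); exact: Cy.
have [_ _ lmax] := ml; have [QE|QE] := lmax Q iQ lQ; [right | by left].
rewrite -/Q QE; apply: max_primary => //; first exact: max_ideal.
by move=> y ly; exists 1%N; rewrite expr1.
Qed.

(* If (l : l) = S, then l is generated locally by some lam with lam w a unit at l,
   for an integral w outside S; an integral equation of w times lam ^+ d then puts
   a power of this unit in l. *)
Lemma singular_self_colon S l : is_order S -> is_lattice l ->
  is_singular S l -> colon l l <> S.
Proof.
move=> oS ll [ml cl] ES; have zl := max_zmod ml.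
have [y [Sy ncy ly]] :=
  associated_prime oS (conductor_lattice oS) (conductor_submod oS) ml cl.
(* [y * x] is the element w of the argument: [y l] lies in the conductor, so [w l] lies in [S]. *)
have [x Ox nSyx] : exists2 x, max_order x & ~ S (y * x).
  by apply: contrapT => H; apply: ncy => x Ox; apply: contrapT => nS; apply: H; exists x.
have [lam ll' nl] : exists2 lam, l lam & ~ l (y * x * lam).
  apply: contrapT => H; apply: nSyx; rewrite -ES => a la.
  by apply: contrapT => nl; apply: H; exists a.
have Slam := max_sub ml ll'.
have Ss : S (y * x * lam) by rewrite mulrAC (mulrC y); exact: ly.
apply: nl; have [d [c xd]] := integral_relation Ox.
have : l ((y * x * lam) ^+ d).
  rewrite mulrAC exprMn xd mulrN mulr_sumr; apply: zmodN => //.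
  apply: zmod_sum => // i _; rewrite -mulrzr mulrA mulrzr; apply: zmodMz => //.
  (* One factor [lam] is set aside, for which [i < d] leaves room; each term is then an [S]-multiple
     of an element of [l]. *)
  have -> : (y * lam) ^+ d * x ^+ i = (y * x * lam) ^+ i * (y * (y * lam) ^+ (d - i.+1)) * lam.
    have -> : (y * lam) ^+ d = (y * lam) ^+ i * (y * lam) ^+ (d - i.+1) * (y * lam).
      by rewrite -mulrA -exprSr -exprD -subSn // subSS subnKC // ltnW.
    by rewrite (exprMn i (y * x)) !exprMn; ring.
  apply: max_mul ml _ ll'; apply: orderM => //; first exact: orderX.
  apply: orderM => //; apply: orderX => //; exact: orderM.
elim: d {xd} => [|d IH]; first by rewrite expr0 => /(max_not1 ml).
by rewrite exprS => /(max_prime oS ml Ss (orderX d oS Ss)) [].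
Qed.

(** If [t S] is contained in [R], then [t] carries the conductor of [S] into that of [R], thus into
    [l]. *)
Lemma extension_singular R l S : is_order R -> is_order S -> R `<=` S ->
  is_singular R l -> localization R l S = localization R l R ->
  is_singular S (idmul l S).
Proof.
move=> oR oS RS [ml cl] E; have ml' := extension_max oR oS RS ml E.
split=> // y cy; apply: contrapT => nly.
have [t [Rt nlt tS]] := common_denominator oR oS ml E.
have Sy := conductor_sub cy.
have lty : l (t * y) by apply: cl => x Ox; rewrite -mulrA; apply: tS; exact: cy.
have [ | lt | ] // := max_prime oS ml' (RS _ Rt) Sy; first exact: sub_extension.
have EC := extension_contraction oR oS ml E; apply: nlt.
by have : (idmul l S `&` R) t by []; rewrite EC.
Qed.

End Singular.

(** * Multiplicator ladders *)

Section LadderSteps.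
Context {K : comUnitRingType}.
Hypothesis pK : is_product_of_number_fields K.
Implicit Types (R S T U l L M P Q : set K) (x y z : K).

Let uK : natunits K := number_fields_natunits pK.

Lemma residue_card R l S L : zmod_closed [in R] -> zmod_closed [in l] ->
  zmod_closed [in L] -> R `<=` S -> L `&` R = l ->
  (forall x, S x -> exists2 r, R r & L (x - r)) ->
  finite_set (residue_ring S L) ->
  finite_set (residue_ring R l) /\
  ncard (residue_ring R l) = ncard (residue_ring S L).
Proof.
move=> zR zl zL RS LR SR fS.
pose g (c : set K) := [set x + y | x in c & y in L].
have lL x : l x -> L x by rewrite -LR => -[].
have gE a : g [set a + b | b in l] = [set a + b | b in L].
  apply/seteqP; split=> [_ [_ [b lb <-] [y Ly <-]]|_ [y Ly <-]].
    by exists (b + y); rewrite ?addrA //; apply: zmodD => //; exact: lL.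
  by exists a; [exists 0; rewrite ?addr0 //; exact: zmod0 | exists y].
have gR : g @` residue_ring R l = residue_ring S L.
  apply/seteqP; split=> [_ [_ [a Ra <-] <-]|_ [a Sa <-]].
    by rewrite gE; exists a => //; exact: RS.
  have [r Rr Lar] := SR a Sa; exists [set r + b | b in l]; first by exists r.
  by rewrite gE; apply/mem_coset => //; rewrite -opprB; exact: zmodN.
have ginj : {in residue_ring R l &, injective g}.
  move=> _ _ /set_mem [a Ra <-] /set_mem [b Rb <-]; rewrite !gE => /mem_coset-/(_ zL) Lab.
  by apply/mem_coset => //; rewrite -LR; split=> //; exact: zmodB.
have fR : finite_set (residue_ring R l).
  by rewrite -(eq_finite_set (inj_card_eq ginj)) gR.
by split=> //; rewrite -gR (ncard_image fR ginj).
Qed.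

Lemma ncard_gt0 (C : choiceType) (A : set C) a : finite_set A -> A a -> (0 < ncard A)%N.
Proof. by move=> fA Aa; rewrite (ncardD1 fA Aa). Qed.

Lemma class_ratio S T (n : nat) : is_order S -> is_order T ->
  finite_set (Cl T) -> finite_set (unit_cosets T S) ->
  (ncard (Cl S) * ncard (unit_cosets T S) = n * ncard (Cl T))%N ->
  (ncard (Cl S))%:R / (ncard (Cl T))%:R = n%:R / (ncard (unit_cosets T S))%:R :> rat.
Proof.
move=> oS oT fT fU E; have T1 := order1 oT.
have c0 : (ncard (Cl T))%:R != 0 :> rat.
  rewrite pnatr_eq0 -lt0n; apply: (ncard_gt0 fT); exists T; last by [].
  split; first exact: order_fractional.
  by exists T; [exact: order_fractional | exact: idmul_order].
have u0 : (ncard (unit_cosets T S))%:R != 0 :> rat.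
  rewrite pnatr_eq0 -lt0n; apply: (ncard_gt0 fU); exists 1; last by [].
  by split=> //; exists 1; rewrite ?mulr1.
by apply/eqP; rewrite eqr_div // -!natrM E.
Qed.

(* An element theta of T \ L killed by L2 modulo L satisfies theta ^ 2 \in L, so that
   S + S theta + L is an order, which is T by minimality. *)
Lemma ladder_step S0 l0 S T L L2 : is_order S0 -> is_order S -> is_order T ->
  S0 `<=` S -> S `<` T -> is_lattice l0 -> is_maximal_ideal S0 l0 ->
  is_maximal_ideal S L -> L `&` S0 = l0 -> T = colon L L ->
  (forall P, is_maximal_ideal T P -> P `&` S0 = l0 -> P = L2) ->
  colon L2 L2 <> T ->
  (forall U, is_order U -> ~ (S `<` U /\ U `<` T)) ->
  [/\ units_outside T L L2 L2, ncard (unit_spans S T L) = ncard (residue_ring S L),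
      forall x, T x -> exists2 s, S s & L2 (x - s), L `<=` L2 &
      ~ L2 `<=` L /\ forall v, L2 v -> ~ L v -> L2 `<=` spanmod S L v].
Proof.
move=> oS0 oS oT S0S [ST nTS] ll0 ml0 mL LS0 TE uniq nT Tmin.
have S0T := subset_trans S0S ST.
have l0L : l0 `<=` L by rewrite -LS0 => x [].
have zL := max_zmod mL; have LS := max_sub mL.
have zS := order_zmod oS; have zT := order_zmod oT.
have lL : is_lattice L by exact: sup_lattice ll0 (order_lattice oS) zL l0L LS.
have mTL : is_submodule T L by rewrite TE; exact: colon_self_submod.
have iTL : is_ideal T L by split=> // x /LS/ST.
have TL : L <> T by move=> E; apply: (max_not1 mL); rewrite E; exact: order1.
(* [T/L] is local: a maximal ideal containing [L] contracts to [l0], where uniqueness applies. *)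
have above P : is_maximal_ideal T P -> L `<=` P -> P = L2.
  move=> mP LP; apply: uniq => //; apply: (max_contraction oS0 ml0 mP) => //.
  exact: subset_trans l0L LP.
have [mL2 LL2] : is_maximal_ideal T L2 /\ L `<=` L2.
  by have [P mP LP] := exists_max oT lL iTL TL; rewrite -(above P mP LP).
have nL2L : ~ L2 `<=` L.
  by move=> L2L; apply: nT; rewrite TE (_ : L2 = L) //; apply/seteqP.
have [th [Tth nLth thL]] := associated_prime oT lL mTL mL2 LL2.
(* The annihilator [J] of [L2] modulo [L] is a proper ideal, so it lies in the unique maximal ideal
   [L2] above [L]. *)
have L2th : L2 th.
  pose J : set K := [set x | T x /\ forall p, L2 p -> L (p * x)].
  have LM x y : T x -> L y -> L (x * y) by exact: submodM.
  have iJ : is_ideal T J.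
    split; last by move=> x [].
    split.
      apply/zmodP; split; first by split=> [|p _]; [|rewrite mulr0]; exact: zmod0.
      move=> x y [Tx Lx] [Ty Ly]; split; first exact: zmodB.
      by move=> p Lp; rewrite mulrBr; apply: zmodB => //; [exact: Lx | exact: Ly].
    move=> a x Ta [Tx Lx]; split; first exact: orderM.
    by move=> p Lp; rewrite mulrCA; apply: LM => //; exact: Lx.
  have LJ : L `<=` J.
    by move=> x Lx; split; [exact/ST/LS | move=> p /(max_sub mL2) Tp; exact: LM].
  have JT : J <> T.
    move=> E; apply: nL2L => p Lp; have [_ /(_ p Lp)] : J 1 by rewrite E; exact: order1.
    by rewrite mulr1.
  have lJ : is_lattice J.
    apply: sup_lattice lL (order_lattice oT) (ideal_zmod iJ) LJ _.
    by case: iJ.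
  have [P mP JP] := exists_max oT lJ iJ JT.
  by rewrite -(above P mP (subset_trans LJ JP)); apply: JP; split.
have L2S : L2 `&` S = L.
  by apply: (max_contraction oS mL mL2).
have nSth : ~ S th by move=> Sth; apply: nLth; rewrite -L2S.
pose N : set K := [set x | exists s t, [/\ S s, S t & L (x - (s + t * th))]].
have NT : N `<=` T.
  move=> x [s [t [Ss St Lx]]]; rewrite -(subrK (s + t * th) x).
  apply: zmodD => //; first exact/ST/LS.
  by apply: zmodD => //; [exact: ST | apply: orderM => //; exact: ST].
have SN : S `<=` N.
  move=> s Ss; exists s, 0; rewrite mul0r addr0 subrr; split=> //; exact: zmod0.
have zN : zmod_closed [in N].
  apply/zmodP; split; first by apply: SN; exact: zmod0.
  move=> x y [s [t [Ss St Lx]]] [s2 [t2 [Ss2 St2 Ly]]].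
  exists (s - s2), (t - t2); split; [exact: zmodB | exact: zmodB |].
  rewrite (_ : _ - _ = x - (s + t * th) - (y - (s2 + t2 * th))); last by ring.
  exact: zmodB.
have LM x y : T x -> L y -> L (x * y) by exact: submodM.
have Lth2 : L (th * th) by exact: thL.
have oN : is_order N.
  apply: orderP => //.
  - exact: sup_lattice (order_lattice oS) (order_lattice oT) zN SN NT.
  - by apply: SN; exact: order1.
  move=> x y Nx Ny; have Tx := NT _ Nx; have Ty := NT _ Ny.
  move: Nx Ny => [s [t [Ss St Lx]]] [s2 [t2 [Ss2 St2 Ly]]].
  have Ts := ST _ Ss; have Tt := ST _ St; have Ts2 := ST _ Ss2; have Tt2 := ST _ St2.
  exists (s * s2), (s * t2 + t * s2); split; first exact: orderM.
    by apply: zmodD => //; exact: orderM.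
  rewrite (_ : _ - _ = y * (x - (s + t * th)) + (s + t * th) * (y - (s2 + t2 * th))
     + t * t2 * (th * th)); last by ring.
  apply: zmodD => //; last by apply: LM => //; exact: orderM.
  apply: zmodD => //; first exact: LM.
  by apply: LM => //; apply: zmodD => //; exact: orderM.
have NE : N = T.
  apply: contrapT => NnT; apply: (Tmin N oN); split; split=> //.
    move=> NS; apply/nSth/NS; exists 0, 1; rewrite mul1r add0r subrr.
    by split; [exact: zmod0 | exact: order1 | exact: zmod0].
  by move=> TN; apply: NnT; apply/seteqP.
have Tgen x : T x -> exists s t, [/\ S s, S t & L (x - (s + t * th))].
  by rewrite -[X in X _ -> _]NE.
have gen2 x : T x -> exists2 s, S s & L2 (x - s).
  move=> /Tgen [s [t [Ss St /LL2 Lx]]]; exists s => //.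
  rewrite (_ : x - s = x - (s + t * th) + t * th); last by ring.
  by apply: zmodD => //; [exact: max_zmod mL2 | apply: max_mul mL2 _ L2th; exact: ST].
(* [T/L] is local and not a field, which leaves the case of a single nonunit residue. *)
have [[[mLT _ _] _]|[P [[mP _ uP] LP _ [_ sP] cP]]|[P [Q [[mP mQ _] PQ E _]]]] :=
  quadratic_trichotomy oS oT ST lL mL mTL Tth nSth Tgen.
- by case: nL2L; rewrite -(above L mLT).
- by have E := above P mP LP; rewrite E in uP mP sP.
have LP : L `<=` P.
  rewrite E => x; rewrite idmulC; apply: idmul_sub; first exact: max_zmod mP.
  by move=> a b /(max_sub mQ) Ta; exact: max_mul mP Ta.
have LQ : L `<=` Q.
  rewrite E => x; apply: idmul_sub; first exact: max_zmod mQ.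
  by move=> a b /(max_sub mP) Ta; exact: max_mul mQ Ta.
by case: PQ; rewrite (above P mP LP) (above Q mQ LQ).
Qed.

Lemma gorenstein_witness S P : is_order S -> is_gorenstein_at S P ->
  is_maximal_ideal S P ->
  exists v, [/\ colon S P v, ~ S v & forall x, colon S P x ->
    exists2 a, S a & S (x - a * v)].
Proof.
move=> oS [v [Pv gen indep]] mP; exists (v ord0); split.
- exact: Pv.
- move=> Sv; apply: (max_not1 mP); apply: (indep (fun=> 1) _ _ ord0).
    by move=> _; exact: order1.
  by rewrite big_ord1 mul1r.
move=> x /gen [a Sa]; rewrite big_ord1 => Sx; by exists (a ord0).
Qed.

(** Either [L (S : L)] is [L], whence [(S : L) = (L : L)], or it is [S], and then the invertible [L]
    would have multiplier ring [S]. The equality turns the Gorenstein condition on [(S : L) / S]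
    into [T = S + S theta]. *)
Lemma colon_max S L T : is_order S -> is_maximal_ideal S L -> T = colon L L ->
  S `<` T -> colon S L = T.
Proof.
move=> oS mL TE [ST nTS]; have zS := order_zmod oS; have zL := max_zmod mL.
have LT : is_submodule T L by rewrite TE; exact: colon_self_submod.
have LS := max_sub mL; have [_ _ Lmax] := mL.
have iI : is_ideal S (idmul L (colon S L)).
  split; first by apply: idmul_submod; apply: submod_sub ST LT.
  by apply: idmul_sub => // x y Lx /(_ x Lx); rewrite mulrC.
have LI : L `<=` idmul L (colon S L).
  move=> x Lx; rewrite -[x]mulr1; apply: mem_idmul => // y /LS.
  by rewrite mul1r.
have [E|E] := Lmax _ iI LI.
  rewrite TE; apply/seteqP; split=> x Hx y Ly; last exact/LS/Hx.
  by rewrite -E mulrC; exact: mem_idmul.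
case: nTS => t Tt; rewrite -[t]mulr1.
suff : S `<=` [set y | S (t * y)] by apply; exact: order1.
rewrite -[X in X `<=` _]E; apply: idmul_sub; first exact: zmod_preimage.
move=> x y Lx Hy /=; rewrite mulrA mulrC; apply: Hy; exact: submodM LT Tt Lx.
Qed.

(* A maximal ideal P with (P : P) = T and (T : P) != T is invertible, so nothing lies
   strictly between P ^ 2 and P. *)
Lemma ramified_square T L P : is_order T -> is_maximal_ideal T P ->
  is_submodule T L -> L `<=` P -> ~ P `<=` L ->
  (forall x y, P x -> P y -> L (x * y)) -> colon P P = T ->
  (exists2 v, colon T P v & ~ T v) -> L = idmul P P.
Proof.
move=> oT mP mL LP nPL PPL PE [v Pv nTv]; have zT := order_zmod oT.
have T1 := order1 oT; have mT := order_submod oT (@subset_refl _ T).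
have [iP _ Pmax] := mP; have mPs := ideal_submod iP; have zP := max_zmod mP.
have mC : is_submodule T (colon T P) by exact: colon_submod.
have C1 : colon T P 1 by move=> y /(max_sub mP); rewrite mul1r.
have PC : idmul P (colon T P) = T.
  have [|||//] := Pmax (idmul P (colon T P)).
  - split; first exact: idmul_submod.
    by apply: idmul_sub => // x y Px /(_ x Px); rewrite mulrC.
  - by move=> x Px; rewrite -[x]mulr1; exact: mem_idmul.
  move=> E; case: nTv; rewrite -PE => y Py.
  by rewrite -E mulrC; exact: mem_idmul.
(* [P] being invertible, [L = P J]. Since [L] contains the square of [P], [J] contains [P]; and
   [J = T] would give [L = P]. *)
pose J := idmul (colon T P) L.
have LJ : L = idmul P J by rewrite /J idmulA PC idmul1.
have iJ : is_ideal T J.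
  split; first exact: idmul_submod.
  by apply: idmul_sub => // x y Hx /LP; exact: Hx.
have PJ : P `<=` J.
  rewrite -[X in X `<=` _](idmul1 T1 mPs) -PC (idmulC P) -idmulA.
  apply: idmulS => //; apply: idmul_sub => //; exact: submod_zmod mL.
have [E|E] := Pmax J iJ PJ; first by rewrite LJ E.
by case: nPL; rewrite LJ E idmulC idmul1.
Qed.

End LadderSteps.

(** * Orders and maximal ideals along the ladder *)

Section Ladder.
Context {K : comUnitRingType} (R l : set K) (d : nat) (O_ : nat -> set K).
Hypotheses (pK : is_product_of_number_fields K) (oR : is_order R).
Hypotheses (sl : is_singular R l) (lad : is_ladder_in_overorders R l d O_).

Let uK : natunits K := number_fields_natunits pK.
Let S0 := O_ d.
Let l0 := idmul l S0.
Let ml : is_maximal_ideal R l. Proof. by case: sl. Qed.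
Let oS0 : is_order S0. Proof. by case: lad => [[]]. Qed.
Let RS0 : R `<=` S0. Proof. by case: lad => [[]]. Qed.
Let loc : localization R l S0 = localization R l R. Proof. by case: lad. Qed.
Let ml0 : is_maximal_ideal S0 l0. Proof. exact: (extension_max oR oS0 RS0 ml loc). Qed.
Let ll0 : is_lattice l0.
Proof. by apply: idmul_lattice; [exact: (singular_lattice pK oR sl) | exact: order_lattice]. Qed.
Let l0R : l0 `&` R = l. Proof. exact: (extension_contraction oR oS0 ml loc). Qed.

Lemma ladder_loverorder i : (i <= d)%N -> is_loverorder S0 l0 (O_ i).
Proof.
move=> id; have [_ _ [_ _ E _]] := lad.
by have : [set O_ i | i in [set i | (i <= d)%N]] (O_ i) by [exists i]; rewrite -E.
Qed.

Lemma loverorder_ladder T : is_loverorder S0 l0 T -> exists2 i, (i <= d)%N & T = O_ i.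
Proof.
move=> lT; have [_ _ [_ _ E _]] := lad.
have : [set S | is_loverorder S0 l0 S] T by [].
by rewrite E => -[i id <-]; exists i.
Qed.

Lemma ladder_order i : (i <= d)%N -> is_order (O_ i).
Proof. by move=> /ladder_loverorder [[]]. Qed.

Lemma ladder_sub i : (i <= d)%N -> S0 `<=` O_ i.
Proof. by move=> /ladder_loverorder [[]]. Qed.

Lemma ladder_proper i : (1 <= i <= d)%N -> O_ i `<` O_ i.-1.
Proof. by have [_ _ [_ H _ _]] := lad; exact: H. Qed.

Lemma ladder_sub0 i : (i <= d)%N -> O_ i `<=` O_ 0%N.
Proof.
elim: i => [_ x Ox|i IH id x Ox]; first exact: Ox.
apply: IH; first exact: ltnW.
by have [sub _] := @ladder_proper i.+1 id; exact: sub.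
Qed.

(** With [d = 0] the ladder would consist of [S0] alone; but [(l0 : l0)] is an [l0]-overorder
    different from [S0], because [l0] is singular in [S0]. *)
Lemma ladder_length_gt0 : (0 < d)%N.
Proof.
rewrite lt0n; apply/eqP => d0.
have [i] := loverorder_ladder (self_colon_loverorder pK oS0 ll0 ml0).
rewrite d0 leqn0 => /eqP -> E.
apply: (singular_self_colon pK oS0 ll0 (extension_singular oR oS0 RS0 sl loc)).
by rewrite E /S0 d0.
Qed.

(** [(P : P)] is again an [l0]-overorder, so it occurs in the ladder and is contained in its largest
    member. *)
Lemma ladder_top P : is_maximal_ideal (O_ 0%N) P -> l0 `<=` P ->
  colon P P = O_ 0%N.
Proof.
move=> mP l0P; set T := O_ 0%N; have oT : is_order T by exact: ladder_order.
have zP := max_zmod mP; have S0T : S0 `<=` T by exact: ladder_sub.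
have T1 := order1 oT; have zS0 := order_zmod oS0.
have lP : is_lattice P.
  exact: sup_lattice ll0 (order_lattice oT) zP l0P (max_sub mP).
have TC : T `<=` colon P P by move=> x Tx y Py; exact: max_mul mP Tx Py.
set Q := colon S0 (colon P P).
have [_ [TS0|[_ _ _ rad]]] := ladder_loverorder (leq0n d).
  (* [(S0 : O_ 0) = S0] would mean [O_ 0 = S0], against [0 < d]. *)
  have d0 := ladder_length_gt0.
  have [_] := @ladder_proper 1%N d0; case => x Tx; apply: (ladder_sub d0).
  have : S0 1 by exact: order1.
  by rewrite -{1}TS0 => /(_ x Tx); rewrite mul1r.
have QS0 x : Q x -> S0 x by move=> /(_ 1 (@colon_self1 _ P)); rewrite mulr1.
have prim : is_primary_for S0 l0 Q.
  apply: (max_primary oS0 ml0).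
  - by split=> //; apply: colon_submod; exact: order_submod.
  - move=> x Qx; rewrite -rad; split; first exact: QS0.
    by exists 1%N; rewrite expr1 => y /TC; exact: Qx.
  move=> y l0y; have : [set x | S0 x /\ exists n, colon S0 (O_ 0%N) (x ^+ n)] y by rewrite rad.
  (* The extra factor [y], which lies in [P], carries [(P : P)] into [O_ 0]; then [y ^+ n] carries
     [O_ 0] into [S0]. *)
  move=> [_ [n Hn]]; exists n.+1 => u Cu; rewrite exprSr -mulrA; apply: Hn.
  by rewrite mulrC; apply: (max_sub mP); apply: Cu; exact: l0P.
have [i id E] : exists2 i, (i <= d)%N & colon P P = O_ i.
  apply: loverorder_ladder; split; last by right.
  by split; [exact: colon_order | exact: subset_trans S0T TC].
by apply/seteqP; split=> //; rewrite E; exact: ladder_sub0.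
Qed.

Definition is_ladder_ideal i L : Prop :=
  [/\ is_maximal_ideal (O_ i) L, L `&` S0 = l0,
      forall M, is_maximal_ideal (O_ i) M -> M `&` S0 = l0 -> M = L,
      O_ i.-1 = colon L L &
      forall U, is_order U -> ~ (O_ i `<` U /\ U `<` O_ i.-1)].

Lemma ladder_ideals : exists L_ : nat -> set K,
  forall i, (1 <= i <= d)%N -> is_ladder_ideal i (L_ i).
Proof.
have [|L_ HL] := @choice _ _ (fun i L => (1 <= i <= d)%N -> is_ladder_ideal i L); last by exists L_.
move=> i; have [id|nid] := boolP (1 <= i <= d)%N; last by exists l0.
have [_ _ [_ _ _ /(_ i id) [L [LE _ CE minE]]]] := lad; exists L => _.
have [mL LS0] : is_maximal_above S0 l0 (O_ i) L.
  by have : [set L] L by []; rewrite -LE.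
split=> // [M mM MS0|].
  by have : [set M | is_maximal_above S0 l0 (O_ i) M] M by []; rewrite LE.
have : [set O_ i.-1] (O_ i.-1) by []. rewrite -minE.
by move=> [_ _ H].
Qed.

Section Ideals.
Variable L_ : nat -> set K.
Hypothesis HL : forall i, (1 <= i <= d)%N -> is_ladder_ideal i (L_ i).

Lemma ladder_ideal_last : L_ d = l0.
Proof.
have [_ _ uniq _ _] := HL (i := d) (introT andP (conj ladder_length_gt0 (leqnn d))).
by symmetry; apply: uniq => //; apply/seteqP; split=> [x []|x lx] //; split=> //; exact: max_sub ml0 x lx.
Qed.

(** The bound [2 <= i] provides the order [O_ i.-2], the multiplier ring of [L_ i.-1]; it differs
    from [O_ i.-1], as [ladder_step] requires. *)
Lemma ladder_ideal_step i : (2 <= i <= d)%N ->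
  [/\ units_outside (O_ i.-1) (L_ i) (L_ i.-1) (L_ i.-1),
      ncard (unit_spans (O_ i) (O_ i.-1) (L_ i)) = ncard (residue_ring (O_ i) (L_ i)),
      forall x, O_ i.-1 x -> exists2 s, O_ i s & L_ i.-1 (x - s), L_ i `<=` L_ i.-1 &
      ~ L_ i.-1 `<=` L_ i /\
      forall v, L_ i.-1 v -> ~ L_ i v -> L_ i.-1 `<=` spanmod (O_ i) (L_ i) v].
Proof.
case: i => [|[|i]] // /andP [_ id].
have [mL LS0 uniq CE Umin] := HL (i := i.+2) (introT andP (conj isT id)).
have [mL2 L2S0 uniq2 CE2 _] := HL (i := i.+1) (introT andP (conj isT (ltnW id))).
apply: (ladder_step oS0 _ _ _ _ ll0 ml0) => //=.
- exact: ladder_order.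
- by apply: ladder_order; exact: ltnW.
- exact: ladder_sub.
- by apply: (@ladder_proper i.+2).
move=> E; have [_] := @ladder_proper i.+1 (introT andP (conj isT (ltnW id))).
by rewrite CE2 E; apply.
Qed.

Lemma ladder_ideal_lattice i : (1 <= i <= d)%N -> is_lattice (L_ i).
Proof.
move=> /[dup] /andP [_ id] /HL [mL LS0 _ _ _].
apply: sup_lattice ll0 (order_lattice (ladder_order id)) (max_zmod mL) _ (max_sub mL).
by rewrite -LS0 => x [].
Qed.

(** [O_ d = R + L_ d], and each step gives [O_ i.-1 = O_ i + L_ i.-1]; hence [O_ i = R + L_ i]
    throughout. *)
Lemma ladder_residue i : (1 <= i <= d)%N ->
  finite_set (residue_ring R l) /\
  ncard (residue_ring R l) = ncard (residue_ring (O_ i) (L_ i)).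
Proof.
move=> id; have /andP [i1 id'] := id; have [mL LS0 _ _ _] := HL id.
(* [k] counts the steps below [d]; [k < d] stops at [O_ 1], as index 0 has no distinguished maximal
   ideal. *)
have gen k : (k < d)%N -> forall x, O_ (d - k) x -> exists2 r, R r & L_ (d - k) (x - r).
  elim: k => [_ x|k IH kd x].
    rewrite subn0 ladder_ideal_last; exact: extension_residue.
  have kd' : (2 <= d - k <= d)%N by rewrite leq_subr andbT ltn_subRL addnC.
  have [_ _ stp LL _] := ladder_ideal_step kd'; rewrite subnS => /stp [s Ss Lxs].
  have [r Rr Lsr] := IH (ltnW kd) s Ss; exists r => //.
  have kd1 : (1 <= (d - k).-1 <= d)%N.
    by rewrite -subnS subn_gt0 kd leq_subr.
  have [mL1 _ _ _ _] := HL kd1.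
  rewrite (_ : x - r = (x - s) + (s - r)); last by ring.
  by apply: (zmodD (max_zmod mL1)) => //; exact: LL.
apply: residue_card.
- exact: order_zmod.
- exact: max_zmod ml.
- exact: max_zmod mL.
- exact: subset_trans RS0 (ladder_sub id').
- rewrite -l0R -LS0; apply/seteqP; split=> [x [Lx Rx]|x [[Lx _] Rx]] //.
  by split=> //; split=> //; exact: RS0.
- have := gen (d - i)%N; rewrite subKn //; apply.
  by rewrite ltn_subrL i1 ladder_length_gt0.
by apply: finite_cosets; [exact: ladder_ideal_lattice | exact/order_lattice/ladder_order].
Qed.

(** The key is [L_ i O_ i.-2 = L_ i.-1]. The product lies between [L_ i] and [L_ i.-1], and exceeds
    [L_ i] because the multiplier ring of [L_ i] is just [O_ i.-1]. As [L_ i.-1] modulo [L_ i] is a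
    line over the residue field, the product fills it. *)
Lemma ladder_ideal_extend i : (1 <= i <= d)%N -> idmul (L_ i) (O_ 0%N) = L_ 1%N.
Proof.
have oT : is_order (O_ 0%N) by exact: ladder_order.
have T1 := order1 oT; have d0 := ladder_length_gt0.
elim: i => // -[_ _|i IH /andP [_ id]].
  have [mL _ _ /= -> _] := HL (i := 1%N) d0.
  rewrite idmulC idmul1 //; first exact: colon_self1.
  by apply: colon_self_submod; exact: max_zmod mL.
rewrite -[RHS](IH (ltnW id)).
have oU : is_order (O_ i) by apply: ladder_order; exact: leq_trans (leqnSn i) (ltnW id).
have UT : O_ i `<=` O_ 0%N by apply: ladder_sub0; exact: leq_trans (leqnSn i) (ltnW id).
rewrite -(idmul1 (order1 oU) (order_submod oT UT)) idmulA; congr idmul; last first.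
  by rewrite idmul1 //; [exact: order1 | exact: order_submod].
have [_ _ _ LL [nLL sp]] := @ladder_ideal_step i.+2 id.
have [mL _ _ /= CE _] := HL (i := i.+2) id.
have [mL2 _ _ /= CE2 _] := HL (i := i.+1) (ltnW id).
have zL2 := max_zmod mL2; have zL := max_zmod mL.
have mUL2 : is_submodule (O_ i) (L_ i.+1) by rewrite CE2; exact: colon_self_submod.
apply/seteqP; split.
  by apply: idmul_sub => // x y /LL Lx Uy; rewrite mulrC; exact: submodM mUL2 Uy Lx.
have Lsub : L_ i.+2 `<=` idmul (L_ i.+2) (O_ i).
  by move=> x Lx; rewrite -[x]mulr1; apply: mem_idmul => //; exact: order1.
have [v Iv nLv] : exists2 v, idmul (L_ i.+2) (O_ i) v & ~ L_ i.+2 v.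
  apply: contrapT => H; have [_] := @ladder_proper i.+1 (ltnW id); apply=> u Uu.
  rewrite CE => x Lx; apply: contrapT => nL; apply: H; exists (u * x) => //.
  by rewrite mulrC; exact: mem_idmul.
apply: subset_trans (sp v _ nLv) _.
  move: v Iv {nLv}; apply: idmul_sub => // x y /LL Lx Uy.
  by rewrite mulrC; exact: submodM mUL2 Uy Lx.
apply: spanmod_sub => //; apply: idmul_submod; split=> // a x Oa Lx.
exact: max_mul mL Oa Lx.
Qed.

End Ideals.

End Ladder.

Theorem theorem5p3 (K : comUnitRingType) (R l : set K)
    (d : nat) (O_ : nat -> set K) :
  is_product_of_number_fields K ->
  is_order R ->
  is_singular R l ->
  (exists (e : nat) (R_ : nat -> set K), is_multiplicator_ladder R l e R_) ->
  is_ladder_in_overorders R l d O_ ->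
  (forall i : nat, (2 <= i <= d)%N ->
     [/\ finite_set (Cl (O_ i)), finite_set (Cl (O_ i.-1)),
         finite_set (residue_ring R l),
         finite_set (unit_cosets (O_ i.-1) (O_ i)) &
         (ncard (Cl (O_ i)))%:R / (ncard (Cl (O_ i.-1)))%:R =
         (ncard (residue_ring R l))%:R
           / (ncard (unit_cosets (O_ i.-1) (O_ i)))%:R :> rat])
  /\
  (is_bass_at R l ->
     [/\ finite_set (Cl (O_ 1%N)), finite_set (Cl (O_ 0%N)),
         finite_set (residue_ring R l),
         finite_set (unit_cosets (O_ 0%N) (O_ 1%N)) &
         exists2 delta : int, is_delta l (O_ 0%N) delta &
         (ncard (Cl (O_ 1%N)))%:R / (ncard (Cl (O_ 0%N)))%:R =
         ((ncard (residue_ring R l))%:R - delta%:~R)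
           / (ncard (unit_cosets (O_ 0%N) (O_ 1%N)))%:R :> rat]).
Proof.
move=> pK oR sl _ lad; have uK := number_fields_natunits pK.
have [L_ HL] := ladder_ideals lad.
have d0 := ladder_length_gt0 pK oR sl lad.
have ord i : (i <= d)%N -> is_order (O_ i) by move=> id; exact: (ladder_order lad id).
have ratio i P Q : (1 <= i <= d)%N -> units_outside (O_ i.-1) (L_ i) P Q ->
    [/\ finite_set (Cl (O_ i)), finite_set (Cl (O_ i.-1)),
        finite_set (residue_ring R l), finite_set (unit_cosets (O_ i.-1) (O_ i)) &
        (ncard (Cl (O_ i)))%:R / (ncard (Cl (O_ i.-1)))%:R =
        (ncard (unit_spans (O_ i) (O_ i.-1) (L_ i)))%:R
          / (ncard (unit_cosets (O_ i.-1) (O_ i)))%:R :> rat].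
  move=> id PQ; have /andP [i1 id'] := id; have [mL LS0 _ CE _] := HL i id.
  have oS := ord i id'; have oT := ord i.-1 (leq_trans (leq_pred i) id').
  have lL := ladder_ideal_lattice pK oR sl lad HL id.
  have LT : is_submodule (O_ i.-1) (L_ i).
    by rewrite CE; apply: colon_self_submod; exact: lattice_zmod.
  have [ST _] := ladder_proper lad id.
  have fT := finite_Cl pK oT.
  have [fS fU E] := class_number_ratio oS oT ST lL mL LT PQ fT.
  have [fR _] := ladder_residue pK oR sl lad HL id.
  by split=> //; exact: class_ratio.
split=> [i /[dup] id /andP [i2 id2]|bass].
  have id1 : (1 <= i <= d)%N by rewrite (ltnW i2).
  have [PQ cX _ _ _] := ladder_ideal_step pK oR sl lad HL id.
  have [fS fT fR fU E] := ratio i _ _ id1 PQ.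
  have [_ cR] := ladder_residue pK oR sl lad HL id1.
  by split=> //; rewrite E cX cR.
have [mL LS0 _ /= CE _] := HL 1%N d0.
have oS := ord 1%N d0; have oT := ord 0%N (leq0n d).
have /= ST := ladder_proper lad (i := 1%N) d0.
have lL := ladder_ideal_lattice pK oR sl lad HL (i := 1%N) d0.
have LT : is_submodule (O_ 0%N) (L_ 1%N).
  by rewrite CE; apply: colon_self_submod; exact: lattice_zmod.
have [[oS0 RS0] loc _] := lad; have [ml _] := sl.
have l0R := extension_contraction oR oS0 ml loc.
have ml0 := extension_max oR oS0 RS0 ml loc.
(* The Bass condition concerns maximal ideals lying over [l] in [R], the ladder those lying over
   [l O_d] in [O_d]; contracting first to [O_d], then to [R], links the two. *)
have above i P : (i <= d)%N -> is_maximal_ideal (O_ i) P ->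
    idmul l (O_ d) `<=` P -> is_gorenstein_at (O_ i) P.
  move=> id mP lP; have S0i := ladder_sub lad id.
  apply: bass; first by split; [exact: ord | exact: subset_trans RS0 S0i].
  split=> //; rewrite -l0R -(max_contraction oS0 ml0 mP S0i lP).
  by apply/seteqP; split=> [x [Px Rx]|x [[Px _] Rx]] //; split=> //; split=> //; exact: RS0.
have l0L : idmul l (O_ d) `<=` L_ 1%N by rewrite -LS0 => x [].
have [th [Cth nSth gen]] := gorenstein_witness oS (above 1%N _ d0 mL l0L) mL.
have CT := colon_max oS mL CE ST.
rewrite CT in Cth gen.
have Tgen x : O_ 0%N x -> exists s t,
    [/\ O_ 1%N s, O_ 1%N t & L_ 1%N (x - (s + t * th))].
  move=> /gen [a Sa Sx]; exists (x - a * th), a; split=> //.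
  by rewrite subrK subrr; apply: zmod0; exact: lattice_zmod.
(* The splitting type refers to [l O_0], the trichotomy to [L_ 1]. *)
have lTL : idmul l (O_ 0%N) = L_ 1%N.
  have d1 : (1 <= d <= d)%N by rewrite d0 leqnn.
  rewrite -(ladder_ideal_extend pK oR sl lad HL d1).
  rewrite (ladder_ideal_last pK oR sl lad HL) -idmulA.
  congr idmul; rewrite idmul1 //; first exact: order1.
  by apply: order_submod => //; exact: (ladder_sub lad (leq0n d)).
have [_ cR] := ladder_residue pK oR sl lad HL (i := 1%N) d0.
have concl P Q delta : units_outside (O_ 0%N) (L_ 1%N) P Q ->
    is_delta l (O_ 0%N) delta ->
    (ncard (unit_spans (O_ 1%N) (O_ 0%N) (L_ 1%N)))%:R =
      (ncard (residue_ring R l))%:R - delta%:~R :> rat ->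
    [/\ finite_set (Cl (O_ 1%N)), finite_set (Cl (O_ 0%N)),
       finite_set (residue_ring R l), finite_set (unit_cosets (O_ 0%N) (O_ 1%N)) &
       exists2 delta : int, is_delta l (O_ 0%N) delta &
       (ncard (Cl (O_ 1%N)))%:R / (ncard (Cl (O_ 0%N)))%:R =
       ((ncard (residue_ring R l))%:R - delta%:~R)
         / (ncard (unit_cosets (O_ 0%N) (O_ 1%N)))%:R :> rat].
  move=> PQ dl cX; have /= [fS fT fR fU E] := ratio 1%N P Q d0 PQ.
  by split=> //; exists delta; rewrite // E cX.
have [STs _] := ST.
have [[PQ cX]|[P [PQ LP nPL [sq _] cX]]|[P [Q [PQ PnQ LE cX]]]] :=
  quadratic_trichotomy oS oT STs lL mL LT Cth nSth Tgen.
- apply: (concl _ _ (-1) PQ); last by rewrite cX cR mulrN1z opprK -natr1.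
  by apply: Or31; split=> //; rewrite /is_inert lTL; case: PQ.
- apply: (concl _ _ 0 PQ); last by rewrite cX cR subr0.
  apply: Or32; split=> //; have [mP _ _] := PQ; exists P => //; rewrite lTL.
  have lP := subset_trans l0L LP.
  (* The Gorenstein condition, now at [O_ 0], makes [(O_ 0 : P)] larger than [O_ 0], whereas
     [(P : P)] equals [O_ 0]. *)
  have [v [Pv nTv _]] := gorenstein_witness oT (above 0%N _ (leq0n d) mP lP) mP.
  apply: (ramified_square oT mP LT LP nPL sq); last by exists v.
  exact: (ladder_top pK oR sl lad mP lP).
apply: (concl _ _ 1 PQ); last by rewrite -cR in cX; rewrite -cX -natr1 addrK.
by apply: Or33; split=> //; have [mP mQ _] := PQ; exists P, Q; rewrite lTL.
Qed.
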